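(* Let $R$ be a commutative ring with identity and let $S$ be a multiplicative subset of $R$. Then the following assertions hold. (1) If $R$ is a strongly $S$-Laskerian ring, then $\Omega_S(R)\subseteq\mathbb{N}$. Moreover, the converse holds if $R$ is locally divided: if $R$ is locally divided and $\Omega_S(R)\subseteq\mathbb{N}$, then $R$ is strongly $S$-Laskerian. (2) If $R$ is an arithmetical ring, then the following are equivalent: (a) $R$ is an $S$-Noetherian ring. (b) $R$ is a strongly $S$-Laskerian ring. (c) $\Omega_S(R)\subseteq\mathbb{N}$.
   Context: $\mathbb{N}$ is the set of positive integers. A multiplicative subset $S$ of $R$ is a nonempty subset closed under multiplication (not necessarily saturated, and not required to contain $1$). For $n\in\mathbb{N}$, an ideal $I$ of $R$ disjoint from $S$ is $S$-$n$-absorbing if there exists $s\in S$ such that whenever $r_1,\dots,r_{n+1}\in R$ satisfy $r_1\cdots r_{n+1}\in I$, there is $1\le j\le n+1$ with $s\prod_{1\le i\le n+1,\, i\ne j} r_i\in I$. For an ideal $I$ of $R$ disjoint from $S$, $\omega_{R,S}(I)$ is the least $n\in\mathbb{N}$ such that $I$ is $S$-$n$-absorbing, and $\omega_{R,S}(I)=\infty$ if no such $n$ exists. Put $\Omega_S(R)=\{\omega_{R,S}(I) : I \text{ is an ideal of } R \text{ disjoint from } S\}$; thus $\Omega_S(R)\subseteq\mathbb{N}$ means that every ideal of $R$ disjoint from $S$ is $S$-$n$-absorbing for some $n\in\mathbb{N}$. For $s\in R$, $I:s=\{r\in R : sr\in I\}$. An ideal $Q$ of $R$ is $S$-primary if $Q\cap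 S=\emptyset$ and there exists $s\in S$ such that whenever $ab\in Q$ with $a,b\in R$, either $sa\in Q$ or $sb\in\sqrt{Q}$. An $S$-primary ideal $Q$ is strongly $S$-primary if $t(\sqrt{Q})^k\subseteq Q$ for some $k\in\mathbb{N}$ and $t\in S$. $R$ is strongly $S$-Laskerian if for each proper ideal $I$ of $R$ disjoint from $S$ there exists $s\in S$ such that $I:s$ is an intersection of finitely many strongly $S$-primary ideals of $R$. $R$ is $S$-Noetherian if for each ideal $I$ of $R$ there exist $s\in S$ and a finitely generated ideal $J$ of $R$ with $sI\subseteq J\subseteq I$. $R$ is arithmetical if $(A+B)\cap C=(A\cap C)+(B\cap C)$ for all ideals $A,B,C$ of $R$. An ideal $I$ of a commutative ring $R$ is divided if for each $a\in R$, either $a\in I$ or $I\subsetneq aR$. A ring is divided if each of its prime ideals is divided, and $R$ is locally divided if $R_M$ is a divided ring for each maximal ideal $M$ of $R$. *)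

(* Defs.v *)
From HB Require Import structures.
From mathcomp Require Import all_boot all_algebra.
From mathcomp Require Import generic_quotient ring.
From mathcomp Require Import boolp classical_sets.

Set Implicit Arguments.
Unset Strict Implicit.
Unset Printing Implicit Defensive.

Import GRing.Theory.

Local Open Scope classical_set_scope.
Local Open Scope ring_scope.
Local Open Scope quotient_scope.

(* Ideals are arbitrary subsets [set R]; unlike [idealr_closed] of
   ring_quotient, the unit ideal is allowed.  Rings are [comPzRingType], so the
   zero ring is allowed as well. *)
Section Ideals.
Variable R : comPzRingType.
Implicit Types (I J P : set R).

Definition is_ideal I : Prop :=
  [/\ I 0, (forall x y, I x -> I y -> I (x + y))
         & (forall a x, I x -> I (a * x))].

Definition ideal_gen (A : set R) : set R := smallest is_ideal A.

Definition principal (a : R) : set R := [set a * x | x in [set: R]].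

Definition finitely_generated J : Prop :=
  exists l : seq R, J = ideal_gen [set x | x \in l].

Definition ideal_add I J : set R := [set x + y | x in I & y in J].

Definition ideal_mul I J : set R := ideal_gen [set x * y | x in I & y in J].

Definition ideal_exp I (k : nat) : set R := iter k (ideal_mul I) [set: R].

Definition scale (s : R) I : set R := [set s * x | x in I].

Definition colon I (s : R) : set R := [set r | I (s * r)].

Definition radical I : set R := [set r | exists2 n, (0 < n)%N & I (r ^+ n)].

Definition prime_ideal P : Prop :=
  [/\ is_ideal P, P <> [set: R] & forall a b, P (a * b) -> P a \/ P b].

Definition maximal_ideal P : Prop :=
  [/\ is_ideal P, P <> [set: R] &
      forall J, is_ideal J -> P `<=` J -> J = P \/ J = [set: R]].

Definition divided_ideal I : Prop := forall a, I a \/ I `<` principal a.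

Definition arithmetical : Prop :=
  forall A B C, is_ideal A -> is_ideal B -> is_ideal C ->
    ideal_add A B `&` C = ideal_add (A `&` C) (B `&` C).

Lemma ideal1 I : is_ideal I -> I 1 -> I = [set: R].
Proof.
by move=> [_ _ IM] I1; apply/seteqP; split=> // x _; rewrite -[x]mulr1; apply: IM.
Qed.

Lemma prime_ideal1 P : prime_ideal P -> ~ P 1.
Proof. by move=> [iP nP _] /(ideal1 iP). Qed.

Lemma maximal_prime P : maximal_ideal P -> prime_ideal P.
Proof.
move=> [iP nP mP]; have [P0 PD PM] := iP; split=> // a b Pab.
pose J := ideal_add P (principal a).
have iJ : is_ideal J.
  split.
  - by exists 0 => //; exists 0; rewrite ?addr0 //; exists 0; rewrite ?mulr0.
  - move=> _ _ [x Px] [_ [u _ <-] <-] [y Py] [_ [v _ <-] <-].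
    exists (x + y); first exact: PD.
    by exists (a * (u + v)); [exists (u + v) | rewrite mulrDr addrACA].
  - move=> c _ [x Px] [_ [u _ <-] <-].
    exists (c * x); first exact: PM.
    by exists (a * (c * u)); [exists (c * u) | rewrite mulrDr (mulrCA a)].
have PJ : P `<=` J.
  by move=> x Px; exists x => //; exists 0; rewrite ?addr0 //; exists 0; rewrite ?mulr0.
have [JE|JT] := mP _ iJ PJ.
  left; rewrite -JE; exists 0 => //; exists a; rewrite ?add0r //.
  by exists 1; rewrite ?mulr1.
right; have [x Px [_ [u _ <-] xu1]] : J 1 by rewrite JT.
rewrite -[b]mulr1 -xu1 mulrDr; apply: PD; first exact: PM.
by rewrite mulrA [b * a]mulrC [_ * u]mulrC; apply: PM.
Qed.

End Ideals.

Definition divided_ring (R : comPzRingType) : Prop :=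
  forall P : set R, prime_ideal P -> divided_ideal P.

(* The localization R_P: pairs (a, d) with d outside P, modulo
   (a, d) ~ (b, e) iff u (a e - b d) = 0 for some u outside P. *)
Section Localization.
Variables (R : comPzRingType) (P : set R) (primeP : prime_ideal P).

Record ratio_at : Type := RatioAt {
  ratio_val :> R * R;
  _ : ~~ `[< P ratio_val.2 >] }.

HB.instance Definition _ := [isSub for ratio_val].
HB.instance Definition _ := [Choice of ratio_at by <:].

Implicit Types x y z : ratio_at.

Lemma ratio_atP x : ~ P x.2. Proof. by case: x => ? /= /asboolPn. Qed.

Lemma notP_mul a b : ~ P a -> ~ P b -> ~ P (a * b).
Proof. by have [_ _ pP] := primeP; move=> Pa Pb /pP []. Qed.

Definition mk_ratio (a d : R) (Pd : ~ P d) : ratio_at :=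
  @RatioAt (a, d) (introT (asboolPn _) Pd).

Definition ratio_eq x y : bool :=
  `[< exists2 u, ~ P u & u * (x.1 * y.2) = u * (y.1 * x.2) >].

Lemma ratio_eqP x y :
  reflect (exists2 u, ~ P u & u * (x.1 * y.2) = u * (y.1 * x.2)) (ratio_eq x y).
Proof. exact: asboolP. Qed.

Lemma ratio_eq_refl : reflexive ratio_eq.
Proof. by move=> x; apply/ratio_eqP; exists 1 => //; apply: prime_ideal1. Qed.

Lemma ratio_eq_sym : symmetric ratio_eq.
Proof. by move=> x y; apply/ratio_eqP/ratio_eqP => -[u Pu e]; exists u. Qed.

Lemma ratio_eq_trans : transitive ratio_eq.
Proof.
move=> y x z /ratio_eqP[u Pu xy] /ratio_eqP[v Pv yz]; apply/ratio_eqP.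
exists (u * v * y.2); first by apply: notP_mul (ratio_atP (x := y)); apply: notP_mul.
have -> : u * v * y.2 * (x.1 * z.2) = v * z.2 * (u * (x.1 * y.2)) by ring.
have -> : u * v * y.2 * (z.1 * x.2) = u * x.2 * (v * (z.1 * y.2)) by ring.
by rewrite xy -yz; ring.
Qed.

Canonical ratio_equiv :=
  EquivRel ratio_eq ratio_eq_refl ratio_eq_sym ratio_eq_trans.

Definition localization : Type := {eq_quot ratio_eq}.

HB.instance Definition _ : EqQuotient _ ratio_eq localization :=
  EqQuotient.on localization.
HB.instance Definition _ := Choice.on localization.

Definition ratio_add x y : ratio_at :=
  mk_ratio (x.1 * y.2 + y.1 * x.2)
           (notP_mul (ratio_atP (x := x)) (ratio_atP (x := y))).
Definition ratio_mul x y : ratio_at :=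
  mk_ratio (x.1 * y.1) (notP_mul (ratio_atP (x := x)) (ratio_atP (x := y))).
Definition ratio_opp x : ratio_at := mk_ratio (- x.1) (ratio_atP (x := x)).
Definition ratio_of (a : R) : ratio_at := mk_ratio a (prime_ideal1 primeP).

Definition loc_add := lift_op2 localization ratio_add.
Definition loc_mul := lift_op2 localization ratio_mul.
Definition loc_opp := lift_op1 localization ratio_opp.
Definition to_loc := lift_embed localization ratio_of.
Canonical to_loc_pi_morph := PiEmbed to_loc.

Lemma ratio_repr x : exists2 u, ~ P u &
  u * (x.1 * (repr (\pi_localization x)).2) =
  u * ((repr (\pi_localization x)).1 * x.2).
Proof. by apply/ratio_eqP; rewrite -eqmodE reprK. Qed.

Lemma pi_loc_add : {morph \pi : x y / ratio_add x y >-> loc_add x y}.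
Proof.
move=> x y; unlock loc_add; apply/eqmodP/ratio_eqP => /=.
have [u Pu eu] := ratio_repr x; have [v Pv ev] := ratio_repr y.
move: (repr (\pi x)) (repr (\pi y)) eu ev => x' y' eu ev.
exists (u * v); first exact: notP_mul.
transitivity (v * y.2 * y'.2 * (u * (x.1 * x'.2)) +
              u * x.2 * x'.2 * (v * (y.1 * y'.2))); first by ring.
by rewrite eu ev; ring.
Qed.
Canonical pi_loc_add_morph := PiMorph2 pi_loc_add.

Lemma pi_loc_mul : {morph \pi : x y / ratio_mul x y >-> loc_mul x y}.
Proof.
move=> x y; unlock loc_mul; apply/eqmodP/ratio_eqP => /=.
have [u Pu eu] := ratio_repr x; have [v Pv ev] := ratio_repr y.
move: (repr (\pi x)) (repr (\pi y)) eu ev => x' y' eu ev.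
exists (u * v); first exact: notP_mul.
transitivity ((u * (x.1 * x'.2)) * (v * (y.1 * y'.2))); first by ring.
by rewrite eu ev; ring.
Qed.
Canonical pi_loc_mul_morph := PiMorph2 pi_loc_mul.

Lemma pi_loc_opp : {morph \pi : x / ratio_opp x >-> loc_opp x}.
Proof.
move=> x; unlock loc_opp; apply/eqmodP/ratio_eqP => /=.
have [u Pu eu] := ratio_repr x; exists u => //.
by rewrite !mulNr !mulrN eu.
Qed.
Canonical pi_loc_opp_morph := PiMorph1 pi_loc_opp.

Lemma pi_ratioP x y : x.1 * y.2 = y.1 * x.2 -> x = y %[mod localization].
Proof.
move=> e; apply/eqmodP/ratio_eqP; exists 1; first exact: prime_ideal1.
by rewrite e.
Qed.

Lemma loc_addA : associative loc_add.
Proof.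
elim/quotW=> x; elim/quotW=> y; elim/quotW=> z; rewrite !piE.
by apply: pi_ratioP => /=; ring.
Qed.

Lemma loc_addC : commutative loc_add.
Proof.
elim/quotW=> x; elim/quotW=> y; rewrite !piE.
by apply: pi_ratioP => /=; ring.
Qed.

Lemma loc_add0 : left_id (to_loc 0) loc_add.
Proof. by elim/quotW=> x; rewrite !piE; apply: pi_ratioP => /=; ring. Qed.

Lemma loc_addN : left_inverse (to_loc 0) loc_opp loc_add.
Proof. by elim/quotW=> x; rewrite !piE; apply: pi_ratioP => /=; ring. Qed.

HB.instance Definition _ :=
  GRing.isZmodule.Build localization loc_addA loc_addC loc_add0 loc_addN.

Lemma loc_mulA : associative loc_mul.
Proof.
elim/quotW=> x; elim/quotW=> y; elim/quotW=> z; rewrite !piE.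
by apply: pi_ratioP => /=; ring.
Qed.

Lemma loc_mulC : commutative loc_mul.
Proof.
elim/quotW=> x; elim/quotW=> y; rewrite !piE.
by apply: pi_ratioP => /=; ring.
Qed.

Lemma loc_mul1 : left_id (to_loc 1) loc_mul.
Proof. by elim/quotW=> x; rewrite !piE; apply: pi_ratioP => /=; ring. Qed.

Lemma loc_mulDl : left_distributive loc_mul loc_add.
Proof.
elim/quotW=> x; elim/quotW=> y; elim/quotW=> z; rewrite !piE.
by apply: pi_ratioP => /=; ring.
Qed.

HB.instance Definition _ := GRing.Zmodule_isComPzRing.Build localization
  loc_mulA loc_mulC loc_mul1 loc_mulDl.

Definition loc_frac (a d : R) (Pd : ~ P d) : localization :=
  \pi_localization (mk_ratio a Pd).

Lemma loc_fracW (K : localization -> Prop) :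
  (forall a d (Pd : ~ P d), K (loc_frac a Pd)) -> forall w, K w.
Proof.
move=> KP; elim/quotW => x.
have -> : x = mk_ratio x.1 (ratio_atP (x := x)).
  by apply: val_inj => /=; case: (ratio_val x).
exact: KP.
Qed.

Lemma loc_frac_eq a d (Pd : ~ P d) b e (Pe : ~ P e) :
  loc_frac a Pd = loc_frac b Pe <->
  exists2 u, ~ P u & u * (a * e) = u * (b * d).
Proof. by split=> [/eqmodP/ratio_eqP|h]; last by apply/eqmodP/ratio_eqP. Qed.

Lemma loc_frac_add a d (Pd : ~ P d) b e (Pe : ~ P e) :
  loc_frac a Pd + loc_frac b Pe =
  loc_frac (a * e + b * d) (notP_mul Pd Pe).
Proof.
by rewrite /loc_frac [LHS]/GRing.add /= !piE; apply: pi_ratioP.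
Qed.

Lemma loc_frac_mul a d (Pd : ~ P d) b e (Pe : ~ P e) :
  loc_frac a Pd * loc_frac b Pe = loc_frac (a * b) (notP_mul Pd Pe).
Proof.
by rewrite /loc_frac [LHS]/GRing.mul /= !piE; apply: pi_ratioP.
Qed.

End Localization.

Definition locally_divided (R : comPzRingType) : Prop :=
  forall (M : set R) (maxM : maximal_ideal M),
    divided_ring (localization (maximal_prime maxM)).

Section SNotions.
Variables (R : comPzRingType) (S : set R).
Implicit Types (I J Q : set R).

(* 1 need not belong to S. *)
Definition multiplicative : Prop :=
  S !=set0 /\ forall s t, S s -> S t -> S (s * t).

Definition S_ideal I : Prop := is_ideal I /\ I `&` S = set0.

Definition S_absorbing (n : nat) I : Prop :=
  S_ideal I /\
  exists2 s, S s & forall r : 'I_n.+1 -> R, I (\prod_i r i) ->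
    exists j, I (s * \prod_(i | i != j) r i).

(* [None] stands for infinity. *)
Definition omega I : option nat :=
  match pselect (exists n, `[< (0 < n)%N /\ S_absorbing n I >]) with
  | left exn => Some (ex_minn exn)
  | right _ => None
  end.

Definition Omega : set (option nat) := [set omega I | I in S_ideal].

Definition posnats : set (option nat) := [set Some n | n in [set n | (0 < n)%N]].

Definition S_primary Q : Prop :=
  S_ideal Q /\
  exists2 s, S s & forall a b, Q (a * b) -> Q (s * a) \/ radical Q (s * b).

Definition strongly_S_primary Q : Prop :=
  S_primary Q /\
  exists k t, [/\ (0 < k)%N, S t & scale t (ideal_exp (radical Q) k) `<=` Q].

Definition strongly_S_Laskerian : Prop :=
  forall I, I <> [set: R] -> S_ideal I ->
    exists2 s, S s & exists (n : nat) (Q : 'I_n -> set R),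
      (forall i, strongly_S_primary (Q i)) /\
      colon I s = \bigcap_(i in [set: 'I_n]) Q i.

Definition S_Noetherian : Prop :=
  forall I, is_ideal I ->
    exists s J, [/\ S s, is_ideal J, finitely_generated J,
                    scale s I `<=` J & J `<=` I].

End SNotions.

(* Main.v *)
Require Import Defs.
From mathcomp Require Import all_boot all_algebra.
From mathcomp Require Import generic_quotient ring.
From mathcomp Require Import boolp classical_sets.

(** For S-absorbing I with constant s, the ideals I : s^k stabilise and the stable
    one is n-absorbing in the usual sense; likewise, for a strongly S-primary Q
    some Q : s is primary, contains a power of its radical, and is stable under
    division by S.  So everything reduces to ordinary absorbing and primary
    ideals J.

    A finite intersection of primary ideals containing powers of their radicals
    is absorbing.  Conversely, when primes below a maximal ideal are comparable,
    an n-absorbing J with prime radical is primary and contains a power of its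
    radical; if a b lies in the radical but neither factor does, J splits as
    (J : e^m) and (J : f^m) with e + f = 1, and this stops because a family that
    is orthogonal modulo the radical has at most n members.

    For S-Noetherian rings, Noetherian induction on the S-saturated ideals rests
    on omega(I) <= omega(I + aR) + omega(I : a).  In an arithmetical ring with
    absorbing ideals, I is principal locally at each prime M disjoint from S, and
    primary decomposition of principal ideals spreads this out to e I <= x R with
    e outside M; hence the multipliers sending I into a finitely generated
    subideal meet S. *)

Set Implicit Arguments.
Unset Strict Implicit.
Unset Printing Implicit Defensive.

(* [Defs] comes last: [GRing.Theory] has a [multiplicative] of its own. *)
Import GRing.Theory Defs.

Local Open Scope classical_set_scope.
Local Open Scope ring_scope.

(** * Ideals and maximal ideals *)

Section IdealTheory.
Variable R : comPzRingType.
Implicit Types (I J K P Q X : set R) (T : finType).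

Section Closure.
Variable I : set R.
Hypothesis iI : is_ideal I.

Lemma ideal0 : I 0. Proof. by case: iI. Qed.
Lemma idealD x y : I x -> I y -> I (x + y).
Proof. by case: iI => _ + _; apply. Qed.
Lemma idealMl a x : I x -> I (a * x). Proof. by case: iI => _ _; apply. Qed.
Lemma idealMr a x : I x -> I (x * a). Proof. by rewrite mulrC; apply: idealMl. Qed.
Lemma idealN x : I x -> I (- x). Proof. by rewrite -mulN1r; apply: idealMl. Qed.
Lemma idealB x y : I x -> I y -> I (x - y).
Proof. by move=> Ix /idealN; apply: idealD. Qed.

Lemma ideal_sum (A : Type) (r : seq A) (p : pred A) (F : A -> R) :
  (forall i, p i -> I (F i)) -> I (\sum_(i <- r | p i) F i).
Proof. by move=> IF; elim/big_ind: _ => //; [apply: ideal0 | apply: idealD]. Qed.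

Lemma idealX_le x m n : (m <= n)%N -> I (x ^+ m) -> I (x ^+ n).
Proof. by move=> mn Ix; rewrite -(subnK mn) exprD; apply: idealMl. Qed.

Lemma ideal_prod_sub T (r : T -> R) (A B : {set T}) :
  B \subset A -> I (\prod_(i in B) r i) -> I (\prod_(i in A) r i).
Proof.
move=> BA IB; rewrite (big_setID B) /= (finset.setIidPr BA).
exact: idealMr.
Qed.

Lemma ideal_colon s : is_ideal (colon I s).
Proof.
split; rewrite /colon /=; first by rewrite mulr0; apply: ideal0.
- by move=> x y; rewrite mulrDr; apply: idealD.
- by move=> a x Ix; rewrite mulrCA; apply: idealMl.
Qed.

Lemma sub_colon s : I `<=` colon I s. Proof. by move=> x; apply: idealMl. Qed.

Lemma sub_radical : I `<=` radical I. Proof. by move=> x Ix; exists 1. Qed.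

Lemma ideal_radical : is_ideal (radical I).
Proof.
split.
- by exists 1 => //; rewrite expr1; apply: ideal0.
- move=> x y [m m0 Ix] [n n0 Iy]; exists (m + n)%N; first by rewrite addn_gt0 m0.
  rewrite exprDn; apply: ideal_sum => i _; rewrite -mulr_natr; apply: idealMr.
  have [ni|/ltnW ni] := leqP n i; first by apply/idealMl/(idealX_le ni).
  by apply: idealMr; apply: idealX_le Ix; rewrite -addnBA ?leq_addr.
- by move=> a x [n n0 Ix]; exists n => //; rewrite exprMn; apply: idealMl.
Qed.

Lemma radical_exp k x : radical I (x ^+ k.+1) -> radical I x.
Proof. by move=> [n n0 Ix]; exists (k.+1 * n)%N; rewrite ?muln_gt0 // exprM. Qed.

End Closure.

Lemma ideal_cap I J : is_ideal I -> is_ideal J -> is_ideal (I `&` J).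
Proof.
move=> iI iJ; split; first by split; apply: ideal0.
- by move=> x y [? ?] [? ?]; split; apply: idealD.
- by move=> a x [? ?]; split; apply: idealMl.
Qed.

Lemma ideal_principal (a : R) : is_ideal (principal a).
Proof.
split; first by exists 0; rewrite ?mulr0.
- by move=> _ _ [x _ <-] [y _ <-]; exists (x + y); rewrite ?mulrDr.
- by move=> b _ [x _ <-]; exists (b * x); rewrite // mulrCA.
Qed.

Lemma ideal_ideal_add I J : is_ideal I -> is_ideal J -> is_ideal (ideal_add I J).
Proof.
move=> iI iJ; split.
- by exists 0; [apply: ideal0|exists 0; [apply: ideal0|rewrite addr0]].
- move=> _ _ [x Ix [y Jy <-]] [x' Ix' [y' Jy' <-]].
  exists (x + x'); first exact: idealD.
  by exists (y + y'); [apply: idealD | rewrite addrACA].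
- move=> a _ [x Ix [y Jy <-]]; exists (a * x); first exact: idealMl.
  by exists (a * y); [apply: idealMl | rewrite mulrDr].
Qed.

Lemma sub_ideal_addl I J : is_ideal J -> I `<=` ideal_add I J.
Proof. by move=> iJ x Ix; exists x => //; exists 0; [apply: ideal0|rewrite addr0]. Qed.

Lemma sub_ideal_addr I J : is_ideal I -> J `<=` ideal_add I J.
Proof. by move=> iI x Jx; exists 0; [apply: ideal0|exists x; rewrite ?add0r]. Qed.

Lemma principal_id (a : R) : principal a a. Proof. by exists 1; rewrite ?mulr1. Qed.

Lemma ideal_idealgen X : is_ideal (ideal_gen X).
Proof.
split; first by move=> K [/ideal0].
- by move=> x y Xx Xy K XK; apply: idealD (Xx _ XK) (Xy _ XK); case: XK.
- by move=> a x Xx K XK; apply: idealMl (Xx _ XK); case: XK.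
Qed.

Lemma sub_idealgen X : X `<=` ideal_gen X. Proof. by move=> x Xx K [_]; apply. Qed.

Lemma idealgen_sub X I : is_ideal I -> X `<=` I -> ideal_gen X `<=` I.
Proof. by move=> iI XI x; apply. Qed.

Lemma ideal_bigcup (F : set (set R)) :
  F !=set0 -> (forall I, F I -> is_ideal I) -> total_on F subset ->
  is_ideal (\bigcup_(I in F) I).
Proof.
move=> [I0 FI0] iF tF; split; first by exists I0 => //; apply: ideal0; apply: iF.
- move=> x y [I FI Ix] [J FJ Jy]; have [IJ|JI] := tF _ _ FI FJ.
    by exists J => //; apply: idealD => //; [apply: iF | apply: IJ].
  by exists I => //; apply: idealD => //; [apply: iF | apply: JI].
- by move=> a x [I FI Ix]; exists I => //; apply: idealMl => //; apply: iF.
Qed.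

(* [Zorn_bigcup] also tests the empty chain, whose union is not an ideal. *)
Lemma Zorn_ideal (C : set (set R)) I0 :
  C I0 -> (forall I, C I -> is_ideal I) ->
  (forall F : set (set R), F !=set0 -> F `<=` C -> total_on F subset ->
     C (\bigcup_(I in F) I)) ->
  exists2 M, C M & forall J, C J -> M `<=` J -> J = M.
Proof.
move=> CI0 iC chainC.
have [|M [CM maxM]] := @Zorn_bigcup R [set X | C X \/ X = set0].
  move=> F FC tF; pose F' := F `&` C.
  have UE : \bigcup_(X in F) X = \bigcup_(X in F') X.
    apply/seteqP; split=> x [X FX Xx]; exists X => //; last by case: FX.
    by split=> //; have [//|X0] := FC _ FX; rewrite X0 in Xx.
  have [[X F'X]|nF'] := pselect (F' !=set0).
    left; rewrite UE; apply: chainC; first by exists X.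
      by move=> Y [].
    by move=> Y Z [FY _] [FZ _]; apply: tF.
  right; rewrite UE; apply/seteqP; split=> x // [X F'X]; case: nF'.
  by exists X.
have CM' : C M.
  case: CM => // M0; exfalso; apply: (maxM I0); last by left.
  rewrite M0; split=> //.
  by move=> /(_ 0 (ideal0 (iC _ CI0))).
exists M => // J CJ MJ; apply: contrapT => JM; apply: (maxM J); last by left.
by split=> // JM'; apply: JM; apply/seteqP.
Qed.

(** If [a] and [b] lie outside a maximal such [M], both [M + aR] and [M + bR] meet [X], and the
    product of the two elements found lies in [M + abR]. The maximality clause is kept because
    [X = {1}] then yields maximal ideals. *)
Lemma exists_prime_disjoint X I :
  X !=set0 -> (forall x y, X x -> X y -> X (x * y)) ->
  is_ideal I -> (forall x, I x -> ~ X x) ->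
  exists M, [/\ prime_ideal M, I `<=` M, (forall x, M x -> ~ X x) &
    forall J, is_ideal J -> M `<=` J -> (forall x, J x -> ~ X x) -> J = M].
Proof.
move=> [x0 Xx0] XM iI IX.
have [||F [J0 FJ0] FC tF|M [iM IM MX] maxM] :=
    @Zorn_ideal [set J | [/\ is_ideal J, I `<=` J & forall x, J x -> ~ X x]] I.
- by split.
- by move=> J [].
- split.
  + by apply: ideal_bigcup => //; [exists J0 | move=> J /FC[]].
  + by move=> x Ix; exists J0 => //; have [_ + _] := FC _ FJ0; apply.
  + by move=> x [J /FC[_ _ +]]; apply.
exists M; split=> //; last first.
  move=> J iJ MJ JX; apply: maxM => //; split=> //.
  exact: subset_trans MJ.
split=> //; first by move=> MT; apply: (MX x0); rewrite ?MT.
have meets a : ~ M a -> exists2 x, X x & exists m r, M m /\ x = m + a * r.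
  move=> Ma; apply: contrapT => nX; apply: Ma.
  have iK := ideal_ideal_add iM (ideal_principal a).
  have MK : M `<=` ideal_add M (principal a).
    exact/sub_ideal_addl/ideal_principal.
  rewrite -(maxM _ _ MK); first exact/sub_ideal_addr/principal_id.
  split=> //; first exact: subset_trans MK.
  move=> x [m Mm [_ [r _ <-] xE]] Xx; apply: nX; exists x => //.
  by exists m, r.
move=> a b Mab; apply: contrapT => /not_orP[/meets[x Xx [m [r [Mm xE]]]]].
move=> /meets[y Xy [m' [r' [Mm' yE]]]].
apply: (MX (x * y)); last exact: XM.
have -> : x * y = m * y + a * r * m' + (a * b) * (r * r') by rewrite xE yE; ring.
apply: idealD => //; last exact: idealMr.
by apply: idealD => //; [apply: idealMr | apply: idealMl].
Qed.

Lemma exists_maximal I : is_ideal I -> ~ I 1 -> exists2 M, maximal_ideal M & I `<=` M.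
Proof.
move=> iI I1.
have [||x Ix x1|M [[iM MT pM] IM _ maxM]] := @exists_prime_disjoint [set 1] I _ _ iI.
- by exists 1.
- by move=> x y -> ->; rewrite mulr1.
- by apply: I1; rewrite -x1.
exists M => //; split=> // J iJ MJ.
have [J1|J1] := pselect (J 1); first by right; apply: ideal1.
by left; apply: maxM => // x Jx x1; apply: J1; rewrite -x1.
Qed.

Lemma prime_idealX P x k : prime_ideal P -> P (x ^+ k) -> P x.
Proof.
move=> pP; elim: k => [/(prime_ideal1 pP)//|k IH].
by rewrite exprS; have [_ _ h] := pP => /h[].
Qed.

Lemma radical_sub_prime P I : prime_ideal P -> I `<=` P -> radical I `<=` P.
Proof. by move=> pP IP x [n _ /IP]; apply: prime_idealX. Qed.

End IdealTheory.

(** * Absorbing and primary ideals *)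

Section Absorbing.
Variable R : comPzRingType.
Implicit Types (I J K P Q X : set R) (T : finType).

(* Equivalent to dropping one of n.+1 factors, by repeated dropping. *)
Definition absorbing (n : nat) I : Prop :=
  forall T (r : T -> R) (A : {set T}), I (\prod_(i in A) r i) ->
  exists B : {set T}, [/\ B \subset A, (#|B| <= n)%N & I (\prod_(i in B) r i)].

Definition primary Q : Prop :=
  [/\ is_ideal Q, ~ Q 1 & forall a b, Q (a * b) -> Q a \/ radical Q b].

(** For an ideal [J] this says that [J] contains the [k]-th power of [X], phrased with indexed
    products so that it combines with [absorbing]. *)
Definition power_sub X (k : nat) J : Prop :=
  forall T (b : T -> R) (A : {set T}),
  (forall i, i \in A -> X (b i)) -> (k <= #|A|)%N -> J (\prod_(i in A) b i).

Definition strongly_primary Q : Prop :=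
  primary Q /\ exists k, power_sub (radical Q) k Q.

Inductive finite_cap (C : set R -> Prop) : set R -> Prop :=
| finite_capT : finite_cap C [set: R]
| finite_capI Q J : C Q -> finite_cap C J -> finite_cap C (Q `&` J).

Lemma finite_cap2 (C : set R -> Prop) I J :
  finite_cap C I -> finite_cap C J -> finite_cap C (I `&` J).
Proof.
move=> cI cJ; elim: cI => [|Q K CQ _ IH]; first by rewrite setTI.
by rewrite -setIA; constructor.
Qed.

Lemma finite_cap_mono (C D : set R -> Prop) I :
  (forall Q, C Q -> D Q) -> finite_cap C I -> finite_cap D I.
Proof.
move=> CD; elim=> [|Q J CQ _ IH]; first exact: finite_capT.
by apply: finite_capI => //; apply: CD.
Qed.

Lemma finite_cap1 (C : set R -> Prop) I : C I -> finite_cap C I.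
Proof. by move=> CI; rewrite -[I]setIT; constructor=> //; apply: finite_capT. Qed.

Lemma finite_cap_ideal (C : set R -> Prop) I :
  (forall Q, C Q -> is_ideal Q) -> finite_cap C I -> is_ideal I.
Proof. by move=> Ci; elim=> // Q J /Ci iQ _; apply: ideal_cap. Qed.

Lemma finite_capP (C : set R -> Prop) I : finite_cap C I <->
  exists n (Q : 'I_n -> set R), (forall i, C (Q i)) /\
    I = \bigcap_(i in [set: 'I_n]) Q i.
Proof.
split.
  elim=> [|Q J CQ _ [n [F [CF ->]]]].
    exists 0%N, (fun=> setT); split; first by case.
    by apply/seteqP; split.
  exists n.+1, (fun i => if unlift ord0 i is Some j then F j else Q); split.
    by move=> i; case: unliftP.
  apply/seteqP; split=> [x [Qx Fx] i _|x Fx].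
    by case: unliftP => // j _; apply: Fx.
  split; first by have := Fx ord0 Logic.I; rewrite unlift_none.
  by move=> j _; have := Fx (lift ord0 j) Logic.I; rewrite liftK.
move=> [n [Q [CQ ->]]].
have cap (l : seq 'I_n) : finite_cap C [set x | forall i, i \in l -> Q i x].
  elim: l => [|j l IH].
    rewrite (_ : [set _ | _] = setT); first exact: finite_capT.
    by apply/seteqP; split.
  rewrite (_ : [set _ | _] = Q j `&` [set x | forall i, i \in l -> Q i x]).
    exact: finite_capI.
  apply/seteqP; split=> x /=.
    move=> h; split; first by apply: h; rewrite mem_head.
    by move=> i il; apply: h; rewrite inE il orbT.
  by move=> [Qx h] i; rewrite inE => /orP[/eqP->|/h].
rewrite (_ : \bigcap_(_ in _) _ = [set x | forall i, i \in enum 'I_n -> Q i x]) //.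
apply/seteqP; split=> x h i //= _; first exact: h.
by apply: h; rewrite mem_enum.
Qed.

Lemma absorbing_cap m n I J : is_ideal I -> is_ideal J ->
  absorbing m I -> absorbing n J -> absorbing (m + n) (I `&` J).
Proof.
move=> iI iJ aI aJ T r A [/aI[B [BA Bm IB]] /aJ[D [DA Dn JD]]].
exists (B :|: D); split; first by rewrite finset.subUset BA.
  by rewrite (leq_trans (leq_card_setU _ _)) ?leq_add.
by split; [apply: ideal_prod_sub IB | apply: ideal_prod_sub JD] => //;
  rewrite (finset.subsetUl, finset.subsetUr).
Qed.

(** The factor [x] is adjoined at index [None] of [option T]: the chosen subset either drops it, or
    keeps it and has fewer than [n] other factors. *)
Lemma absorbingM n I x T (r : T -> R) (A : {set T}) :
  absorbing n I -> I (x * \prod_(i in A) r i) ->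
  exists2 B : {set T}, B \subset A &
    ((#|B| <= n)%N /\ I (\prod_(i in B) r i)) \/
    ((#|B| < n)%N /\ I (x * \prod_(i in B) r i)).
Proof.
move=> aI Ix; pose f i := if i is Some j then r j else x.
have SomeI : {in predT &, injective (@Some T)} by move=> ? ? _ _ [].
have prodS (B : {set T}) : \prod_(i in Some @: B) f i = \prod_(i in B) r i.
  by rewrite big_imset // => ? ? _ _ [].
have NS (B : {set T}) : None \notin Some @: B by apply/imsetP => -[].
have cardS (B : {set T}) : #|Some @: B| = #|B| by rewrite card_imset // => ? ? [].
have [|D [DA Dn ID]] := aI _ f (None |: Some @: A).
  by rewrite big_setU1 //= prodS.
pose B := [set i | Some i \in D]%SET.
have BA : B \subset A.
  apply/fintype.subsetP=> i; rewrite inE => /(fintype.subsetP DA); rewrite !inE /=.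
  by case/imsetP=> j jA [->].
exists B => //; have [ND|ND] := boolP (None \in D).
  have DE : D = None |: Some @: B.
    apply/setP=> -[i|]; last by rewrite ND !inE.
    by rewrite !inE /= mem_imset ?inE // => ? ? [].
  right; move: Dn ID; rewrite DE cardsU1 NS cardS add1n => Dn.
  by rewrite big_setU1 //= prodS.
have DE : D = Some @: B.
  apply/setP=> -[i|]; last by rewrite (negPf ND) (negPf (NS _)).
  by rewrite mem_imset ?inE // => ? ? [].
by left; move: Dn ID; rewrite DE cardS prodS.
Qed.

Lemma absorbing_colon n I x : is_ideal I -> absorbing n I -> absorbing n (colon I x).
Proof.
move=> iI aI T r A IA; have [B BA h] := absorbingM (x := x) aI IA.
case: h => -[Bn IB]; exists B; split=> //.
- exact: idealMl.
- exact: ltnW.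
Qed.

Lemma absorbing_exp n I e r m : is_ideal I -> absorbing n I ->
  I (e ^+ m * r) -> I (e ^+ n * r).
Proof.
move=> iI aI Iem; have /(absorbingM aI)[B _ h] : I (r * \prod_(i in [set: 'I_m]%SET) e).
  by rewrite prodr_const cardsT card_ord mulrC.
case: h; rewrite prodr_const => -[Bn IB].
  by apply: idealMr => //; apply: idealX_le IB.
by rewrite mulrC -(subnK (ltnW Bn)) exprD mulrCA; apply: idealMl.
Qed.

Lemma absorbing_radical n I x : is_ideal I -> absorbing n I ->
  radical I x -> I (x ^+ n).
Proof.
move=> iI aI [m _ Im]; rewrite -[_ ^+ _]mulr1.
by apply: (absorbing_exp (m := m)) => //; rewrite mulr1.
Qed.

Lemma absorbing_ord n I : is_ideal I ->
  (forall r : 'I_n.+1 -> R, I (\prod_i r i) -> exists j, I (\prod_(i | i != j) r i)) ->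
  absorbing n I.
Proof.
move=> iI aI T r A; move: {2}#|A| (leqnn #|A|) => k.
elim: k A => [|k IH] A Ak IA.
  by exists A; split=> //; apply: leq_trans Ak _.
have [An|nA] := leqP #|A| n; first by exists A.
(* The factors are grouped into the n.+1 fibres of g, all nonempty. *)
pose g i : 'I_n.+1 := inord (minn (index i (enum A)) n).
have [j Ij] : exists j : 'I_n.+1, I (\prod_(l | l != j) \prod_(i in A | g i == l) r i).
  by apply: aI; rewrite -partition_big.
have gA (l : 'I_n.+1) : exists2 i, i \in A & g i = l.
  have ln : (l < size (enum A))%N by rewrite -cardE (leq_trans (ltn_ord l)).
  have [x0 _] : exists x0, x0 \in A by apply/card_gt0P/(leq_trans _ nA).
  exists (nth x0 (enum A) l); first by rewrite -mem_enum mem_nth.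
  apply: val_inj; rewrite /g index_uniq ?enum_uniq //.
  by rewrite (minn_idPl _) ?inord_val // -ltnS ltn_ord.
pose B := [set i in A | g i != j]%SET.
have BA : B \subset A by apply/fintype.subsetP=> i; rewrite inE => /andP[].
have IB : I (\prod_(i in B) r i).
  rewrite (partition_big g (fun l => l != j)) /=; last by move=> i; rewrite inE => /andP[].
  move: Ij; congr (I _); apply: eq_bigr => l lj; apply: eq_bigl => i; rewrite inE.
  by case: eqP => [->|]; rewrite ?lj ?andbT ?andbF.
have ltBA : (#|B| < #|A|)%N.
  have [i iA gi] := gA j; apply/proper_card/properP; split=> //; exists i => //.
  by rewrite inE gi eqxx andbF.
have [|D [DB Dn ID]] := IH B _ IB; first by rewrite -ltnS (leq_trans ltBA).
by exists D; split=> //; apply: fintype.subset_trans BA.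
Qed.

Lemma power_sub_colon X k J x : X x -> power_sub X k.+1 J -> power_sub X k (colon J x).
Proof.
move=> Xx XJ T b A XA kA; pose f i := if i is Some j then b j else x.
have NS : None \notin Some @: A by apply/imsetP => -[].
have := XJ _ f (None |: Some @: A); rewrite big_setU1 //= big_imset /=; last first.
  by move=> ? ? _ _ [].
apply; last by rewrite cardsU1 NS card_imset // => ? ? [].
by move=> i; rewrite !inE => /orP[/eqP->//|/imsetP[j /XA + ->]].
Qed.

Lemma power_sub_ideal_exp X k J : is_ideal J ->
  power_sub X k J <-> ideal_exp X k `<=` J.
Proof.
move=> iJ; split.
  elim: k J iJ => [|k IH] J iJ XJ.
    move=> x _; rewrite (_ : J = setT) //; apply: ideal1 => //.
    by have := XJ _ (fun=> 0) (finset.set0 : {set unit}); rewrite big_set0; apply;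
      rewrite ?cards0 // => i; rewrite inE.
  apply: idealgen_sub => // _ [x Xx [y Ky <-]].
  by apply: (IH (colon J x)) => //; [apply: ideal_colon | apply: power_sub_colon].
move=> XJ T b A XA kA.
suff h (B : {set T}) : (forall i, i \in B -> X (b i)) ->
    (k <= #|B|)%N -> ideal_exp X k (\prod_(i in B) b i) by apply/XJ/h.
elim: k B {XJ A XA kA} => [//|k IH] B XB kB.
have [i iB] : exists i, i \in B by apply/card_gt0P/(leq_trans _ kB).
rewrite (big_setD1 i) //=; apply: sub_idealgen; exists (b i); first exact: XB.
exists (\prod_(j in B :\ i) b j) => //; apply: IH.
  by move=> j /setD1P[_ /XB].
by rewrite -ltnS (leq_trans kB) // [in X in (X <= _)%N](cardsD1 i) iB.
Qed.

Lemma primary_radical Q : primary Q -> prime_ideal (radical Q).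
Proof.
move=> [iQ Q1 pQ]; split; first exact: ideal_radical.
  move=> QT; have [n _] : radical Q 1 by rewrite QT.
  by rewrite expr1n.
move=> a b [n n0]; rewrite exprMn => /pQ[Qa|]; first by left; exists n.
by case: n n0 => // n _ /radical_exp; right.
Qed.

Lemma primaryMr Q a b : primary Q -> Q (a * b) -> ~ radical Q b -> Q a.
Proof. by move=> [_ _ pQ] /pQ[]. Qed.

(** Factors outside the radical cancel, as their product stays outside this prime; among those
    inside, any [k] already have their product in [Q]. *)
Lemma strongly_primary_absorbing Q : strongly_primary Q -> exists n, absorbing n Q.
Proof.
move=> [pQ [k Qk]]; exists k => T r A QA; have [iQ _ _] := pQ.
pose B := [set i in A | `[< radical Q (r i) >]]%SET.
have BA : B \subset A by apply/fintype.subsetP=> i; rewrite inE => /andP[].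
have QB i : i \in B -> radical Q (r i) by rewrite inE => /andP[_ /asboolP].
have [Bk|/ltnW kB] := leqP #|B| k.
  exists B; split=> //; move: QA; rewrite (big_setID B) /= (finset.setIidPr BA).
  move/(primaryMr pQ); apply; have [irQ rQ1 rQM] := primary_radical pQ.
  elim/big_ind: _ => [/(ideal1 irQ)//|x y nx ny /rQM[]//|i].
  rewrite !inE => /andP[+ iA]; rewrite iA /= => /asboolP; exact.
have [s [us sk sB]] := card_geqP kB.
exists [set i in s]%SET; split.
- by apply/fintype.subsetP=> i; rewrite inE => /sB /(fintype.subsetP BA).
- by rewrite cardsE (card_uniqP us) sk.
- by apply: Qk => [i|]; rewrite ?inE; [move=> /sB/QB | rewrite cardsE (card_uniqP us) sk].
Qed.

Lemma finite_cap_absorbing I : finite_cap strongly_primary I -> exists n, absorbing n I.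
Proof.
elim=> [|Q J sQ cJ [n aJ]].
  by exists 0%N => T r A _; exists finset.set0; rewrite finset.sub0set cards0.
have [m aQ] := strongly_primary_absorbing sQ.
exists (m + n)%N; apply: absorbing_cap => //; first by case: sQ => -[].
by apply: finite_cap_ideal cJ => K [[]].
Qed.

End Absorbing.

(** * Primary decomposition of absorbing ideals *)

Section Decomposition.
Variable R : comPzRingType.
Implicit Types (I J K M P Q X : set R) (T : finType).

(* If x^2 times the product of the others lies in J for all pairs of omitted
   factors, then J absorbs the product of A, as one sees by adjoining the factor
   \sum_(i in A) b i; otherwise two factors are traded for one square. *)
Lemma power_sub_square n X t J : is_ideal J -> absorbing n J ->
  power_sub [set x ^+ 2 | x in X] t J -> power_sub X (t.*2 + n).+2 J.
Proof.
elim: t J => [|t IH] J iJ aJ XJ T b A XA tA.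
  rewrite -[X in J X]mulr1; apply: idealMl => //.
  have := XJ _ (fun=> 0) (finset.set0 : {set unit}); rewrite big_set0; apply=> //.
  by move=> i; rewrite inE.
have [|nA] := pselect (exists i j, [/\ i \in A, j \in A, j != i &
    ~ J (b j ^+ 2 * \prod_(l in A :\ i :\ j) b l)]).
  move=> [i [j [iA jA ji []]]]; apply: (IH (colon J (b j ^+ 2))).
  - exact: ideal_colon.
  - exact: absorbing_colon.
  - by apply: power_sub_colon => //; exists (b j) => //; apply: XA jA.
  - by move=> l; rewrite !inE => /and3P[_ _ /XA].
  - by move: tA; rewrite (cardsD1 i) iA (cardsD1 j (A :\ i)) !inE ji jA doubleS !addSn.
have sq i j : i \in A -> j \in A -> j != i ->
    J (b j ^+ 2 * \prod_(l in A :\ i :\ j) b l).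
  by move=> iA jA ji; apply: contrapT => nJ; apply: nA; exists i, j.
have prodD1 i : i \in A -> \prod_(l in A) b l = b i * \prod_(l in A :\ i) b l.
  by move=> iA; rewrite (big_setD1 i).
have other i j : i \in A -> j \in A :\ i -> J (b j * \prod_(l in A :\ i) b l).
  move=> iA jAi; have [ji jA] := setD1P jAi.
  by rewrite (big_setD1 j jAi) /= mulrA -expr2; apply: sq.
have JA : J ((\sum_(i in A) b i) * \prod_(i in A) b i).
  rewrite mulr_suml; apply: ideal_sum => // j jA.
  have [i iAj] : exists i, i \in A :\ j.
    by apply/card_gt0P; move: tA; rewrite (cardsD1 j) jA add1n ltnS; apply: leq_trans.
  have [ij iA] := setD1P iAj.
  rewrite (prodD1 _ iA) mulrCA; apply: idealMl => //; apply: other => //.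
  by rewrite !inE eq_sym ij.
have [B BA [[Bn JB]|[Bn JB]]] := absorbingM aJ JA.
  exact: ideal_prod_sub JB.
have [i iA iB] : exists2 i, i \in A & i \notin B.
  apply/fintype.subsetPn/negP => /subset_leq_card AB.
  have := leq_trans tA (leq_trans AB (ltnW Bn)).
  by rewrite leqNgt !ltnS -addSn leq_addl.
have JAi : J ((\sum_(j in A) b j) * \prod_(l in A :\ i) b l).
  apply: (ideal_prod_sub (I := colon J _)) JB; first exact: ideal_colon.
  apply/fintype.subsetP=> l lB; rewrite !inE (fintype.subsetP BA) // andbT.
  by apply: contraNneq iB => <-.
rewrite (prodD1 _ iA).
have -> : b i = \sum_(j in A) b j - \sum_(j in A :\ i) b j.
  by rewrite (big_setD1 i iA) /= addrK.
rewrite mulrBl; apply: idealB => //; rewrite mulr_suml.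
by apply: ideal_sum => // j; apply: other.
Qed.

(** The [n]-th powers of radical elements lie in [J], hence so do the [2 ^ n]-th ones;
    [power_sub_square] then halves the exponent until it is 1. *)
Lemma absorbing_power_sub n J : is_ideal J -> absorbing n J ->
  exists k, power_sub (radical J) k J.
Proof.
move=> iJ aJ; pose X e := [set x ^+ (2 ^ e) | x in radical J].
suff h e : (exists k, power_sub (X e) k J) -> exists k, power_sub (X 0%N) k J.
  have [|k Xk] := h n; last first.
    by exists k => T b A XA; apply: Xk => i /XA; exists (b i).
  exists 1%N => T b A XA /card_gt0P[i iA]; rewrite (big_setD1 i) //=.
  apply: idealMr => //; have [x rx <-] := XA _ iA.
  by apply: (idealX_le iJ (ltnW (ltn_expl n (ltnSn 1)))); apply: absorbing_radical aJ rx.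
elim: e => [//|e IH [k Xk]]; apply: IH; exists (k.*2 + n).+2.
apply: power_sub_square => // T b A XA; apply: Xk => i /XA[_ [x rx <-] <-].
by exists x => //; rewrite expnSr exprM.
Qed.

(** Nonzero elements of the reduced ring modulo the radical with pairwise zero products; bounding
    their number replaces counting minimal primes over [J]. *)
Definition orthogonal J T (x : T -> R) : Prop :=
  (forall i, ~ radical J (x i)) /\ forall i j, i != j -> radical J (x i * x j).

Lemma absorbing_of_radical n J : is_ideal J -> absorbing n J -> absorbing n (radical J).
Proof.
(* The exponent is raised to [n.+1] because [radical] asks for a positive one. *)
move=> iJ aJ T r A /(absorbing_radical iJ aJ) /(idealX_le iJ (leqnSn n)).
rewrite -prodrXl => /aJ[B [BA Bn]]; rewrite prodrXl => JB.
by exists B; split=> //; exists n.+1.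
Qed.

(* The product of the sums \sum_(j != i) x j lies in the radical of J, but none
   of its proper subproducts does. *)
Lemma orthogonal_card n J T (x : T -> R) : is_ideal J -> absorbing n J ->
  orthogonal J x -> (#|T| <= n)%N.
Proof.
move=> iJ aJ [nx ox]; rewrite leqNgt; apply/negP=> nT.
have irJ := ideal_radical iJ.
pose y i := \sum_(j | j != i) x j.
have xy k : radical J (x k * y k).
  by rewrite mulr_sumr; apply: ideal_sum => // j jk; apply: ox; rewrite eq_sym.
have rJ : radical J (\prod_(i in [set: T]%SET) y i).
  have [i0 _] : exists i, i \in T by apply/card_gt0P/(leq_trans _ nT).
  set p := \prod_(i in _) _.
  have rp k : radical J (x k * p).
    by rewrite /p (big_setD1 k) ?inE //= mulrA; apply: idealMr.
  (* The square of [p] suffices: [y i0] is a sum of the [x j], and each [x j * p] is in the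
     radical. *)
  apply: (@radical_exp _ _ 1); rewrite expr2.
  rewrite {1}/p (big_setD1 i0) ?inE //= mulrAC; apply: idealMr => //.
  by rewrite mulr_suml; apply: ideal_sum.
have [B [_ Bn rB]] := absorbing_of_radical iJ aJ rJ.
have [k _ kB] : exists2 k, k \in [set: T]%SET & k \notin B.
  apply/fintype.subsetPn/negP => /subset_leq_card; rewrite cardsT => TB.
  by have := leq_ltn_trans (leq_trans TB Bn) nT; rewrite ltnn.
(* Multiplied by [x k], each [y i] with [i != k] acts as [x k] modulo the radical, so a product
   without [y k] becomes a power of [x k]. *)
have [m xm] : exists m, radical J (x k * \prod_(i in B) y i - x k * x k ^+ m).
  pose L z := exists m, radical J (x k * z - x k * x k ^+ m).
  have LM z w : L z -> L w -> L (z * w).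
    move=> [m zm] [m' wm]; exists (m + m')%N.
    have -> : x k * (z * w) - x k * x k ^+ (m + m') =
      w * (x k * z - x k * x k ^+ m) + x k ^+ m * (x k * w - x k * x k ^+ m').
      by rewrite exprD; ring.
    by apply: idealD => //; apply: idealMl.
  have L1 : L 1 by exists 0%N; rewrite expr0 subrr; apply: ideal0.
  rewrite -/(L _); apply: (big_ind L) => // i iB; exists 1%N.
  rewrite expr1 /y (bigD1 k) /=; last by apply: contraNneq kB => ->.
  rewrite mulrDr addrC addKr mulr_sumr; apply: ideal_sum => // j /andP[_ jk].
  by apply: ox; rewrite eq_sym.
apply: (nx k); apply: (@radical_exp _ _ m); rewrite exprS.
rewrite -[X in radical J X](subKr (x k * \prod_(i in B) y i)).
by apply: idealB => //; apply: idealMl.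
Qed.

(** Locally at [M], the prime [P] lies in every principal ideal generated outside [P]; denominators
    are cleared by [u]. Locally divided and arithmetical rings share this property. *)
Definition locally_comparable : Prop := forall M P,
  maximal_ideal M -> prime_ideal P -> P `<=` M ->
  forall a p, ~ P a -> P p -> exists2 u, ~ M u & principal a (u * p).

Hypothesis LC : locally_comparable.

(** Otherwise a maximal [M] contains [colon J a]. Comparability gives [u * a = b ^+ n * c] with [u]
    outside [M]; as [b ^+ n.+1 * c] is in [J], absorption puts [u * a] in [J], so [u] is in [M]. *)
Lemma absorbing_primary n J : is_ideal J -> absorbing n J ->
  prime_ideal (radical J) -> primary J.
Proof.
move=> iJ aJ pJ; split=> //; first by move/(sub_radical)/(prime_ideal1 pJ).
move=> a b Jab; have [|nrb] := pselect (radical J b); first by right.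
left; apply: contrapT => nJa.
have [||M maxM aM] := @exists_maximal R (colon J a); first exact: ideal_colon.
  by rewrite /colon /= mulr1.
have pM := maximal_prime maxM.
have JM : J `<=` M by apply: subset_trans aM; apply: sub_colon.
have ra : radical J a.
  by have [_ _ prJ] := pJ; have [|//|//] := prJ a b; apply: sub_radical.
have nrbn : ~ radical J (b ^+ n) by move=> /(prime_idealX pJ).
have [u Mu [c _ uE]] := LC maxM pJ (radical_sub_prime pM JM) nrbn ra.
apply/Mu/aM; rewrite /colon /= mulrC -uE.
apply: (absorbing_exp (m := n.+1)) aJ _ => //.
by rewrite exprS -mulrA uE mulrCA (mulrC b); apply: idealMl.
Qed.

(** If the two colon ideals lay in one maximal [M], there would be primes over [J] below [M], one
    containing [b] but not [a], the other [a] but not [b]; comparability excludes this. *)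
Lemma radical_comaximal J a b : is_ideal J -> radical J (a * b) ->
  exists e f, [/\ e + f = 1, radical J (a * e) & radical J (b * f)].
Proof.
move=> iJ rab; have irJ := ideal_radical iJ.
have [ia ib] := (ideal_colon irJ a, ideal_colon irJ b).
have [[e re [f rf ef]]|] := pselect (ideal_add (colon (radical J) a) (colon (radical J) b) 1).
  by exists e, f.
move=> /(exists_maximal (ideal_ideal_add ia ib))[M maxM KM]; exfalso.
have pM := maximal_prime maxM.
(* The inclusion says that [c] is not nilpotent modulo [J] locally at [M], so [J] misses the
   products [u * c ^+ k] with [u] outside [M]. *)
have avoid c : colon (radical J) c `<=` M ->
    exists P, [/\ prime_ideal P, J `<=` P, P `<=` M & ~ P c].
  move=> cM; pose X := [set x | exists u k, ~ M u /\ x = u * c ^+ k].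
  have M1 := prime_ideal1 pM.
  have [||x Jx [u [k [Mu xE]]]|P [pP JP PX _]] := @exists_prime_disjoint R X J _ _ iJ.
  - by exists 1; exists 1, 0%N; rewrite mulr1.
  - move=> x y [u [k [Mu ->]]] [v [l [Mv ->]]]; exists (u * v), (k + l)%N.
    by split; [apply: notP_mul | rewrite exprD mulrACA].
  - apply/Mu/cM; exists k.+1 => //.
    have -> : (c * u) ^+ k.+1 = (c * u ^+ k) * x by rewrite xE exprMn !exprS; ring.
    exact: idealMl.
  - exists P; split=> //.
      move=> x Px; apply: contrapT => Mx; apply: (PX x) => //.
      by exists x, 0%N; rewrite mulr1.
    by move=> Pc; apply: (PX c) => //; exists 1, 1%N; rewrite mul1r.
have [|P [pP JP PM Pa]] := avoid a.
  by apply: subset_trans KM; apply: sub_ideal_addl.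
have [|P' [pP' JP' PM' Pb']] := avoid b.
  by apply: subset_trans KM; apply: sub_ideal_addr.
have no_common Q : prime_ideal Q -> J `<=` Q -> ~ Q a -> ~ Q b -> False.
  by move=> pQ JQ Qa Qb; have [_ _ h] := pQ; have [] := h _ _ (radical_sub_prime pQ JQ rab).
have [Pb|Pb] := pselect (P b); last exact: (no_common P).
apply: (no_common P') => // P'a.
have [u Mu [c _ uE]] := LC maxM pP' PM' Pb' P'a.
have : P (u * a) by rewrite -uE; apply: idealMr => //; case: pP.
by have [_ _ h] := pP => /h[/PM|].
Qed.

(* Induction on the size of the families orthogonal modulo the radical: if a b
   lies in the radical and 1 = e + f as above, then J is the intersection of the
   colon ideals by powers of e and f, and a family orthogonal for the former is
   extended by a to one for J. *)
Lemma absorbing_finite_cap n J : is_ideal J -> absorbing n J ->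
  finite_cap (@strongly_primary R) J.
Proof.
have step d I g a : is_ideal I -> absorbing n I -> ~ radical I a -> radical I (a * g) ->
    (forall T (x : T -> R), orthogonal I x -> (#|T| < d.+1)%N) ->
    forall T (x : T -> R), orthogonal (colon I (g ^+ n.+1)) x -> (#|T| < d)%N.
  move=> iI aI na ag dI T x [nx ox].
  pose y i := if i is Some j then g ^+ n.+1 * x j else a.
  have irI := ideal_radical iI.
  rewrite -ltnS -card_option; apply: (dI _ y); split=> [[i|] //|[i|] [j|] ij //=].
  - move=> [m m0 Im]; apply: (nx i); exists m => //; rewrite /colon /= exprS -mulrA.
    (* Absorption lowers the exponent [n.+1 * m] of [g] to [n], which puts [x i ^+ m] in the colon
       ideal. *)
    apply: idealMl => //; apply: (absorbing_exp (m := (n.+1 * m)%N)) aI _ => //.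
    by rewrite exprM -exprMn.
  - have [m m0 Im] := ox i j ij; exists m => //.
    have -> : (g ^+ n.+1 * x i * (g ^+ n.+1 * x j)) ^+ m =
      (g ^+ n.+1 * g ^+ n.+1) ^+ m * (x i * x j) ^+ m by rewrite -exprMn; congr (_ ^+ _); ring.
    case: m m0 Im => // m _ Im; rewrite [(_ * _) ^+ m.+1]exprS.
    have -> z w t : z * z * w * t = z * w * (z * t) :> R by ring.
    exact: idealMl.
  - by rewrite exprS (_ : _ * _ = (a * g) * (g ^+ n * x i)); [apply: idealMr | ring].
  - by rewrite exprS (_ : _ * _ = (a * g) * (g ^+ n * x j)); [apply: idealMr | ring].
move=> iJ aJ; have : forall T (x : T -> R), orthogonal J x -> (#|T| < n.+1)%N.
  by move=> T x; apply: orthogonal_card.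
move: {1}n.+1 => d; elim: d => [|d IH] in J iJ aJ *.
  (* The empty family is orthogonal, so the bound 0 is never met. *)
  move=> /(_ void (fun=> 0)) h; have /h : orthogonal J (fun _ : void => 0) by split; case.
  by rewrite ltn0.
move=> dJ; have [J1|J1] := pselect (J 1).
  by rewrite (ideal1 iJ J1); apply: finite_capT.
have irJ := ideal_radical iJ.
have [[a [b [na nb rab]]]|prJ] :=
    pselect (exists a b, [/\ ~ radical J a, ~ radical J b & radical J (a * b)]).
  have [e [f [ef rae rbf]]] := radical_comaximal iJ rab.
  have JE : J = colon J (e ^+ n.+1) `&` colon J (f ^+ n.+1).
    apply/seteqP; split=> [x Jx|x [xe xf]]; first by split; apply: sub_colon.
    have ix := ideal_colon iJ x.
    (* Both [e] and [f] lie in this radical, hence so does their sum 1. *)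
    have [m _] : radical (colon J x) 1.
      by rewrite -ef; apply: idealD; first exact: ideal_radical;
        exists n.+1; rewrite // /colon /= mulrC.
    by rewrite expr1n /colon /= mulr1.
  rewrite JE; apply: finite_cap2; apply: IH; do ?[exact: ideal_colon | exact: absorbing_colon].
    exact: step rae dJ.
  exact: step rbf dJ.
apply: finite_cap1; split; last exact: absorbing_power_sub aJ.
apply: absorbing_primary aJ _ => //; split=> //.
  by move=> rT; have [m _] : radical J 1; [rewrite rT | rewrite expr1n].
move=> a b rab; apply: contrapT => /not_orP[na nb].
by apply: prJ; exists a, b.
Qed.

End Decomposition.

(** * Divided and arithmetical rings *)

Section LocalComparability.
Variable R : comPzRingType.
Implicit Types (I J K M P Q : set R).

(** Since [P] lies in [M], denominators are outside [P], so membership of the numerator in [P] does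
    not depend on the representative. *)
Lemma loc_frac_extend M (pM : prime_ideal M) P : prime_ideal P -> P `<=` M ->
  prime_ideal [set w | exists p d (Md : ~ M d), P p /\ w = loc_frac pM p Md].
Proof.
move=> pP PM; have [iP _ prP] := pP.
have M1 := prime_ideal1 pM.
have zeroE : 0 = loc_frac pM 0 M1 by rewrite /loc_frac [LHS]/GRing.zero /= piE; apply: pi_ratioP.
have oneE : 1 = loc_frac pM 1 M1 by rewrite /loc_frac [LHS]/GRing.one /= piE; apply: pi_ratioP.
have num_in a d (Md : ~ M d) p e (Me : ~ M e) :
    P p -> loc_frac pM a Md = loc_frac pM p Me -> P a.
  move=> Pp /loc_frac_eq[u Mu uE].
  have : P (u * (a * e)) by rewrite uE; apply: idealMl => //; apply: idealMr.
  by case/prP=> [/PM //|/prP[//|/PM]].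
split.
- split; first by exists 0, 1, M1; split=> //; apply: ideal0.
  + move=> _ _ [p [d [Md [Pp ->]]]] [q [e [Me [Pq ->]]]].
    rewrite loc_frac_add; exists (p * e + q * d), (d * e), (notP_mul pM Md Me).
    by split=> //; apply: idealD => //; apply: idealMr.
  + move=> w _ [p [d [Md [Pp ->]]]]; elim/loc_fracW: w => a e Me.
    rewrite loc_frac_mul; exists (a * p), (e * d), (notP_mul pM Me Md).
    by split=> //; apply: idealMl.
- move=> QT; have [p [d [Md [Pp]]]] : [set w | exists p d (Md : ~ M d),
    P p /\ w = loc_frac pM p Md] 1 by rewrite QT.
  by rewrite oneE => /(num_in _ _ _ _ _ _ Pp) /(prime_ideal1 pP).
- elim/loc_fracW=> a d Md; elim/loc_fracW=> b e Me [p [f [Mf [Pp]]]].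
  rewrite loc_frac_mul => /(num_in _ _ _ _ _ _ Pp)/prP[Pa|Pb].
    by left; exists a, d, Md.
  by right; exists b, e, Me.
Qed.

Lemma locally_divided_comparable : locally_divided R -> locally_comparable R.
Proof.
move=> ldR M P maxM pP PM a p Pa Pp.
have pM := maximal_prime maxM; have M1 := prime_ideal1 pM.
have [iP _ prP] := pP.
have := ldR M maxM _ (loc_frac_extend (maximal_prime maxM) pP PM).
move=> /(_ (loc_frac _ a M1))[[q [d [Md [Pq]]]]|[sub _]].
  move=> /loc_frac_eq[u Mu uE]; have : P (u * (a * d)).
    by rewrite uE; apply: idealMl => //; apply: idealMr.
  by case/prP=> [/PM //|/prP[//|/PM]].
have [|w _] := sub (loc_frac _ p M1); first by exists p, 1, M1.
elim/loc_fracW: w => b e Me; rewrite loc_frac_mul => /loc_frac_eq[u Mu uE].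
exists (u * e); first exact: notP_mul.
exists (u * b) => //; transitivity (u * (a * b * 1)); first by ring.
by rewrite uE; ring.
Qed.

(* Distributivity is applied to aR, which is contained in bR + (a - b)R. *)
Lemma arithmetical_comaximal : arithmetical R -> forall a b : R,
  exists u v, [/\ u + v = 1, principal b (u * a) & principal a (v * b)].
Proof.
move=> arR a b.
have := arR _ _ _ (ideal_principal b) (ideal_principal (a - b)) (ideal_principal a).
move=> /seteqP[/(_ a)[]]; first split; last 1 first.
(* Here [a = p + (a - b) * t] with both terms in [aR] and [p] in [bR]; then [u = 1 - t] and
   [v = t]. *)
- move=> p [pb pa] [_ [[t _ <-] qa] apq] _.
  exists (1 - t), t; split; first by rewrite subrK.
    have -> : (1 - t) * a = p - t * b by rewrite (canRL (addrK _) apq); ring.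
    apply: idealB => //; first exact: ideal_principal.
    by exists t; rewrite // mulrC.
  have -> : t * b = t * a - (a - b) * t by ring.
  by apply: idealB => //; [apply: ideal_principal|exists t; rewrite // mulrC].
- exists b; first exact: principal_id.
  by exists (a - b); [apply: principal_id | rewrite addrC subrK].
- exact: principal_id.
Qed.

Lemma arithmetical_comparable : arithmetical R -> locally_comparable R.
Proof.
move=> arR M P maxM pP PM a p Pa Pp; have pM := maximal_prime maxM.
have [u [v [uv1 [c _ ua] vp]]] := arithmetical_comaximal arR a p.
exists v => // Mv; have [iM _ _] := pM; have [iP _ prP] := pP.
have : P (u * a) by rewrite -ua; apply: idealMr.
case/prP=> // /PM Mu; apply: (prime_ideal1 pM).
by rewrite -uv1; apply: idealD.
Qed.

End LocalComparability.

(** * Saturation *)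

Section Multiplicative.
Variables (R : comPzRingType) (S : set R).
Hypothesis hS : multiplicative S.
Implicit Types (I J K M P Q : set R).

Lemma multiplicativeM s t : S s -> S t -> S (s * t).
Proof. by case: hS => _ + Ss St; apply. Qed.

Lemma multiplicativeX s n : S s -> S (s ^+ n.+1).
Proof. by move=> Ss; elim: n => // n IH; rewrite exprS; apply: multiplicativeM. Qed.

Lemma disjointE I : I `&` S = set0 <-> forall x, S x -> ~ I x.
Proof.
split=> [IS x Sx Ix|IS]; first by have : set0 x by rewrite -IS.
by apply/seteqP; split=> // x [Ix /IS].
Qed.

Lemma disjoint_radical I x : I `&` S = set0 -> S x -> ~ radical I x.
Proof. by move=> /disjointE IS Sx [[|n] // _]; apply/IS/multiplicativeX. Qed.

Definition saturated K : Prop := forall t x, S t -> K (t * x) -> K x.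

Lemma S_absorbing_colon n I : S_absorbing S n I ->
  exists2 s, S s & absorbing n (colon I s).
Proof.
move=> [[iI /disjointE IS] [s Ss aI]].
have stab k x : I (s ^+ (n.*2 + k) * x) -> I (s ^+ n.*2 * x).
  elim: k x => [|k IH] x; first by rewrite addn0.
  (* Dropping a square loses two factors [s] and the constant restores one, so the exponent falls by
     exactly one; dropping factor 0 instead would leave a power of [s] in [I]. *)
  pose r (i : 'I_n.+1) := if i == ord0 then s ^+ k.+1 * x else s ^+ 2.
  have rE (p : pred 'I_n.+1) : \prod_(i | p i && (i != ord0)) r i =
      (s ^+ 2) ^+ #|[pred i | p i & i != ord0]|.
    by rewrite -prodr_const; apply: eq_big => // i /andP[_ /negPf]; rewrite /r => ->.
  have card0 : #|[pred i : 'I_n.+1 | i != ord0]| = n by rewrite cardC1 card_ord.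
  move=> Ik; have [|j] := aI r.
    rewrite (bigD1 ord0) //= (rE predT) card0 /r eqxx -exprM mul2n.
    by move: Ik; congr (I _); rewrite exprD; ring.
  have [->|j0] := eqVneq j ord0.
    have -> : \prod_(i | i != ord0) r i = (s ^+ 2) ^+ n by rewrite -[in RHS]card0 -(rE predT).
    by rewrite -exprM -exprS => /IS[]; apply: multiplicativeX.
  rewrite (bigD1 ord0) 1?eq_sym //= rE /r eqxx -exprM.
  have -> : #|[pred i : 'I_n.+1 | i != j & i != ord0]| = n.-1.
    rewrite -[in RHS]card0 [in RHS](cardD1 j) inE j0 /=.
    by apply: eq_card => i; rewrite !inE.
  move=> Ij; apply: IH; move: Ij; congr (I _).
  have n0 : (0 < n)%N by case: (n) j j0 => // -[[]].
  rewrite mulrA mulrA -exprS mulrAC -exprD; congr (s ^+ _ * _).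
  by case: (n) n0 => // m _; rewrite /= mul2n doubleS addnC !addnS !addSn.
exists (s ^+ n.*2.+1); first exact: multiplicativeX.
apply: absorbing_ord => [|r]; first exact: ideal_colon.
rewrite /colon /= => Ir.
(* The multiplier is merged into factor 0, so that only [n.+1] factors remain; [stab] removes the
   surplus powers of [s] afterwards. *)
pose r' i := if i == ord0 then s ^+ n.*2.+1 * r i else r i.
have [|j Ij] := aI r'.
  move: Ir; congr (I _); rewrite [in LHS](bigD1 ord0) //= [in RHS](bigD1 ord0) //= /r' eqxx.
  by rewrite mulrA; congr (_ * _); apply: eq_bigr => i /negPf ->.
exists j; rewrite exprS -mulrA; apply: idealMl => //; apply: (stab 2).
have [j0|j0] := eqVneq j ord0; last first.
  move: Ij; congr (I _); rewrite [in LHS](bigD1 ord0) 1?eq_sym //=.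
  rewrite [in RHS](bigD1 ord0) 1?eq_sym //= {1}/r' eqxx.
  rewrite (eq_bigr r) => [|i /andP[_ /negPf i0]]; last by rewrite /r' i0.
  by rewrite addn2 !exprS; ring.
rewrite addn2 exprSr -mulrA; apply: idealMl => //; move: Ij; congr (I (_ * _)).
by rewrite j0; apply: eq_bigr => i /negPf i0; rewrite /r' i0.
Qed.

Lemma colon_S_absorbing n I s : S_ideal S I -> S s -> absorbing n (colon I s) ->
  exists2 m, (0 < m)%N & S_absorbing S m I.
Proof.
(* The bound [n.+1] is visibly positive, and at most [n] of the [n.+2] indices are kept, so one can
   be omitted. *)
move=> [iI IS] Ss aI; exists n.+1 => //; split=> //; exists s => // r Ir.
have iIs := ideal_colon iI s.
have [|B [_ Bn IB]] := aI _ r [set: 'I_n.+2]%SET.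
  by apply: sub_colon => //; move: Ir; congr (I _); apply: eq_bigl => i; rewrite inE.
have [j _ jB] : exists2 j, j \in [set: 'I_n.+2]%SET & j \notin B.
  apply/fintype.subsetPn/negP => /subset_leq_card; rewrite cardsT card_ord => nB.
  by have := leq_trans nB (leq_trans Bn (leqnSn n)); rewrite ltnn.
exists j; have : colon I s (\prod_(i in ~: [set j]) r i).
  apply: (ideal_prod_sub iIs) IB; apply/fintype.subsetP=> i iB.
  by rewrite !inE; apply: contraNneq jB => <-.
by rewrite /colon /=; congr (I (_ * _)); apply: eq_bigl => i; rewrite !inE.
Qed.

Lemma Omega_posnatsP : Omega S `<=` posnats <->
  forall I, S_ideal S I -> exists2 m, (0 < m)%N & S_absorbing S m I.
Proof.
split=> [sub I SI|aS _ [I SI <-]].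
  have [|n n0] := sub (omega S I); first by exists I.
  rewrite /omega; case: pselect => // -[m /asboolP[m0 am]] _.
  by exists m.
have [m m0 am] := aS _ SI; rewrite /omega; case: pselect => [ex|[]].
  by case: ex_minnP => k /asboolP[k0 _] _; exists k.
by exists m; apply/asboolP.
Qed.

Lemma Omega_absorbing : Omega S `<=` posnats <->
  forall I, S_ideal S I -> exists2 s, S s & exists n, absorbing n (colon I s).
Proof.
rewrite Omega_posnatsP; split=> aS I SI.
  by have [m _ /S_absorbing_colon[s Ss am]] := aS I SI; exists s => //; exists m.
by have [s Ss [n am]] := aS I SI; apply: colon_S_absorbing am.
Qed.

Definition saturated_primary Q : Prop := strongly_primary Q /\ saturated Q.

Lemma finite_cap_saturated K : finite_cap saturated_primary K -> saturated K.
Proof.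
elim=> // Q J [_ satQ] _ satJ t x St [Qx Jx].
by split; [apply: satQ Qx | apply: satJ Jx].
Qed.

Lemma saturated_primary_ideal K : finite_cap saturated_primary K -> is_ideal K.
Proof. by apply: finite_cap_ideal => Q [[[]]]. Qed.

Lemma colon_saturated K s : is_ideal K -> saturated K -> S s -> colon K s = K.
Proof.
move=> iK satK Ss; apply/seteqP; split; last exact: sub_colon.
by move=> x; apply: satK.
Qed.

Lemma saturated_primary_strongly Q : saturated_primary Q -> strongly_S_primary S Q.
Proof.
move=> [[[iQ Q1 pQ] [k Qk]] satQ]; have [[s Ss] _] := hS; split.
  split; first split=> //.
    by apply/disjointE => t St Qt; apply/Q1/(satQ t); rewrite ?mulr1.
  exists s => // a b /pQ[Qa|rb]; first by left; apply: idealMl.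
  by right; apply: idealMl => //; apply: ideal_radical.
exists k.+1, s; split=> // _ [x xk <-]; apply: idealMl => //; move: x xk.
by apply/power_sub_ideal_exp => // T b A Ab kA; apply: Qk => //; apply: ltnW.
Qed.

(** The constant [s] of [Q] serves: each claim applies the [S]-primary condition to a product with
    [s] moved into the second factor, then cancels elements of [S], none of which is in the
    radical. *)
Lemma strongly_S_primary_colon Q : strongly_S_primary S Q ->
  exists2 s, S s & saturated_primary (colon Q s).
Proof.
move=> [[[iQ QS] [s Ss pQ]] [k [t [k0 St Qk]]]]; exists s => //.
have nr x : S x -> ~ radical Q x by apply: disjoint_radical.
have iQs := ideal_colon iQ s.
have satQ : saturated (colon Q s).
  move=> u x Su Qx; have : Q (x * (s * u)) by move: Qx; congr (Q _); ring.
  by case/pQ=> // /nr[]; do 2?apply: multiplicativeM.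
split=> //; split; [split=> // | ].
- by rewrite /colon /= mulr1 => Qs; apply: (nr s) => //; apply: sub_radical.
- move=> a b Qab; have : Q (a * (s * b)) by move: Qab; congr (Q _); ring.
  case/pQ=> [|[n n0 Qn]]; [by left | right; exists n => //].
  apply: (satQ ((s * s) ^+ n)).
    by case: n n0 {Qn} => // n _; apply/multiplicativeX/multiplicativeM.
  by apply: sub_colon => //; move: Qn; congr (Q _); rewrite -exprMn; congr (_ ^+ _); ring.
- have Qt : power_sub (radical Q) k (colon Q t).
    apply/power_sub_ideal_exp; first exact: ideal_colon.
    by move=> x xk; apply: Qk; exists x.
  exists k => T b A Ab kA; apply: (satQ (t * s ^+ #|A|)).
    (* As [k] is positive, [A] is nonempty and [s ^+ #|A|] is in [S], which may lack 1. *)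
    apply: multiplicativeM => //; case: #|A| (leq_trans k0 kA) => // n _.
    exact: multiplicativeX.
  apply: sub_colon => //; rewrite -mulrA -prodr_const -big_split /=.
  apply: (Qt _ (fun i => s * b i)) => // i /Ab[m m0 Qm]; exists m => //.
  case: m m0 Qm => // m _ Qm; rewrite exprMn exprS mulrAC.
  exact: idealMr.
Qed.

(** Each component has its own divisor; the product serves all, because surplus factors do not
    change a saturated ideal. *)
Lemma finite_cap_strongly_S_primary J : finite_cap (strongly_S_primary S) J ->
  exists2 s, S s & finite_cap saturated_primary (colon J s).
Proof.
have [[s0 Ss0] _] := hS.
elim=> [|Q K pQ _ [s Ss cK]].
  by exists s0 => //; rewrite (_ : colon _ _ = setT) //; apply: finite_capT.
have [t St pQt] := strongly_S_primary_colon pQ.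
exists (t * s); first exact: multiplicativeM.
rewrite (_ : colon _ _ = colon Q t `&` colon K s); first exact: finite_capI.
have [iQt satQ satK] : [/\ is_ideal (colon Q t), saturated (colon Q t)
  & saturated (colon K s)].
  by split; [case: pQt => -[[]] | case: pQt | apply: finite_cap_saturated].
have iKs := saturated_primary_ideal cK.
rewrite -[in RHS](colon_saturated iQt satQ Ss) -[in RHS](colon_saturated iKs satK St).
by apply/seteqP; split=> x [Qx Kx]; split;
  move: Qx Kx; rewrite /colon /= !mulrA // [s * t]mulrC.
Qed.

Lemma finite_cap_strongly_primary J : finite_cap (@strongly_primary R) J ->
  exists2 s, S s & finite_cap saturated_primary (colon J s).
Proof.
have [[s0 Ss0] _] := hS.
elim=> [|Q K pQ _ [s Ss cK]].
  by exists s0 => //; rewrite (_ : colon _ _ = setT) //; apply: finite_capT.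
have [[iQ _ prQ] _] := pQ.
have [iKs satK] := (saturated_primary_ideal cK, finite_cap_saturated cK).
(* A component meeting [S] becomes the unit ideal after division by [q] and disappears; any other
   one is already saturated. *)
have [[q [Sq Qq]]|QS] := pselect (exists q, S q /\ Q q).
  exists (q * s); first exact: multiplicativeM.
  rewrite (_ : colon _ _ = colon K s) // -[RHS](colon_saturated iKs satK Sq).
  apply/seteqP; split=> x; rewrite /colon /= mulrA [s * q]mulrC; first by case.
  by split=> //; rewrite -mulrA; apply: idealMr.
have {}QS : Q `&` S = set0 by apply/disjointE => x Sx Qx; apply: QS; exists x.
have satQ : saturated Q.
  by move=> t x St; rewrite mulrC => /prQ[//|/disjoint_radical[]].
exists s => //; rewrite (_ : colon _ _ = Q `&` colon K s); first exact: finite_capI.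
by rewrite -[in RHS](colon_saturated iQ satQ Ss).
Qed.

Lemma strongly_S_LaskerianP : strongly_S_Laskerian S <->
  forall I, S_ideal S I -> exists2 s, S s & finite_cap saturated_primary (colon I s).
Proof.
split=> [lask I SI|lask I _ SI].
  have [|s Ss [n [Q pQ]]] := lask I _ SI.
    have [[s Ss] _] := hS; case: SI => _ /disjointE IS IT.
    by apply: (IS s) => //; rewrite IT.
  have : finite_cap (strongly_S_primary S) (colon I s) by apply/finite_capP; exists n, Q.
  move=> /finite_cap_strongly_S_primary[t St cI]; exists (s * t).
    exact: multiplicativeM.
  rewrite (_ : colon _ _ = colon (colon I s) t) //.
  by apply/seteqP; split=> x; rewrite /colon /= mulrA.
have [s Ss cI] := lask I SI; exists s => //; apply/finite_capP.
exact: finite_cap_mono saturated_primary_strongly cI.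
Qed.

Lemma Laskerian_absorbing : strongly_S_Laskerian S -> Omega S `<=` posnats.
Proof.
move=> /strongly_S_LaskerianP lask; apply/Omega_absorbing => I /lask[s Ss cI].
exists s => //; apply: finite_cap_absorbing.
by apply: finite_cap_mono cI => Q [].
Qed.

Lemma absorbing_Laskerian : locally_comparable R ->
  Omega S `<=` posnats -> strongly_S_Laskerian S.
Proof.
move=> LC /Omega_absorbing aS; apply/strongly_S_LaskerianP => I SI.
have [s Ss [n aI]] := aS I SI; have iIs := ideal_colon SI.1 s.
have [t St cI] := finite_cap_strongly_primary (absorbing_finite_cap LC iIs aI).
exists (s * t); first exact: multiplicativeM.
rewrite (_ : colon _ _ = colon (colon I s) t) //.
by apply/seteqP; split=> x; rewrite /colon /= mulrA.
Qed.

End Multiplicative.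

(** * S-Noetherian rings *)

Section Noetherian.
Variables (R : comPzRingType) (S : set R).
Hypothesis hS : multiplicative S.
Implicit Types (I J K M P Q : set R).

(** The contraction to [R] of the extension of [I] to the localization at [S]. *)
Definition saturation I : set R := [set x | exists2 t, S t & I (t * x)].

Lemma ideal_saturation I : is_ideal I -> is_ideal (saturation I).
Proof.
have [[s Ss] SM] := hS; move=> iI; split; first by exists s; rewrite // mulr0; apply: ideal0.
- move=> x y [t St tx] [u Su uy]; exists (t * u); first exact: SM.
  have -> : t * u * (x + y) = u * (t * x) + t * (u * y) by ring.
  by apply: idealD => //; apply: idealMl.
- by move=> c x [t St tx]; exists t; rewrite // mulrCA; apply: idealMl.
Qed.

Lemma saturated_saturation I : saturated S (saturation I).
Proof.
have [_ SM] := hS.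
by move=> t x St [u Su ux]; exists (u * t); [apply: SM | rewrite -mulrA].
Qed.

(** The finitely many generators lie in one member of the chain, and saturation cancels [s]. *)
Lemma S_Noetherian_bigcup (F : set (set R)) : S_Noetherian S -> F !=set0 ->
  (forall I, F I -> is_ideal I /\ saturated S I) -> total_on F subset ->
  F (\bigcup_(I in F) I).
Proof.
move=> noeR [I0 FI0] iF tF; set U := \bigcup_(I in F) I.
have iU : is_ideal U by apply: ideal_bigcup => //; [exists I0 | move=> I /iF[]].
have [s [_ [Ss _ [l ->] sU JU]]] := noeR U iU.
have : forall x, x \in l -> U x by move=> x xl; apply: JU; apply: sub_idealgen.
move=> lU; have [I FI lI] : exists2 I, F I & forall x, x \in l -> I x.
  elim: l lU {sU JU} => [|x l IH] lU; first by exists I0.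
  have [|I FI lI] := IH; first by move=> y yl; apply: lU; rewrite inE yl orbT.
  have [J FJ Jx] := lU x (mem_head _ _).
  have [IJ|JI] := tF _ _ FI FJ.
    by exists J => // y; rewrite inE => /orP[/eqP->//|/lI/IJ].
  by exists I => // y; rewrite inE => /orP[/eqP->|/lI//]; apply: JI.
have [iI satI] := iF I FI.
suff -> : U = I by [].
apply/seteqP; split=> x Ux; last by exists I.
by apply: (satI s) => //; apply: (idealgen_sub iI lI); apply: sU; exists x.
Qed.

(** A maximal counterexample [M] is not prime. For [a * b] in [M] with neither factor in [M], the
    saturation of [M + aR] and [colon M a] are larger, hence absorbing, and their bounds add up. *)
Lemma S_Noetherian_saturated_absorbing I : S_Noetherian S -> is_ideal I ->
  saturated S I -> exists n, absorbing n I.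
Proof.
move=> noeR iI satI; apply: contrapT => naI.
pose C J := [/\ is_ideal J, saturated S J & ~ exists n, absorbing n J].
have [|J|F F0 FC tF|M [iM satM naM] maxM] := @Zorn_ideal R C I.
- by split.
- by move=> [].
- apply: (FC); apply: S_Noetherian_bigcup => // J /FC[].
  by split.
have larger J x : is_ideal J -> saturated S J -> M `<=` J -> J x -> ~ M x ->
    exists n, absorbing n J.
  by move=> iJ satJ MJ Jx Mx; apply: contrapT => naJ; apply: Mx; rewrite -(maxM J).
have M1 : ~ M 1.
  move=> /(ideal1 iM) MT; apply: naM; rewrite MT; exists 0%N => T r A _.
  by exists finset.set0; rewrite finset.sub0set cards0.
have [[a [b [Mab Ma Mb]]]|prM] :=
    pselect (exists a b, [/\ M (a * b), ~ M a & ~ M b]); last first.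
  apply/naM/strongly_primary_absorbing; split.
    split=> // a b Mab; have [|Ma] := pselect (M a); [by left | right].
    by apply: sub_radical; apply: contrapT => Mb; apply: prM; exists a, b.
  exists 1%N => T b A Ab /card_gt0P[i iA]; rewrite (big_setD1 i) //=.
  apply: idealMr => //; have [n _] := Ab _ iA; elim: n => [/M1//|n IH].
  rewrite exprS => Mi; apply: contrapT => Mb; apply: prM; exists (b i), (b i ^+ n).
  by split=> // /IH.
have iMa := ideal_ideal_add iM (ideal_principal a).
have sMa : M `<=` ideal_add M (principal a) by apply/sub_ideal_addl/ideal_principal.
pose K := saturation (ideal_add M (principal a)).
have iK : is_ideal K := ideal_saturation iMa.
have satK : saturated S K := @saturated_saturation _.
have [[s0 Ss0] SM] := hS.
have MK : M `<=` K by move=> x Mx; exists s0 => //; apply: sMa; apply: idealMl.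
have Ka : K a by exists s0 => //; apply: idealMl => //; apply/sub_ideal_addr/principal_id.
have satMa : saturated S (colon M a).
  by move=> t x St Mx; apply: (satM t) => //; move: Mx; rewrite /colon /= mulrCA.
have [m aK] := larger K a iK satK MK Ka Ma.
have [n aMa] := larger _ b (ideal_colon iM a) satMa (@sub_colon _ _ iM a) Mab Mb.
apply: naM; exists (m + n)%N => T r A MA.
have [B [BA Bm [t St [i Mi [_ [x _ <-] tE]]]]] := aK _ _ _ (MK _ MA).
(* Up to [t], the product over [B] is [a * x] modulo [M], so the remaining factors together with [x]
   are handled by [colon M a]. *)
have Mx : colon M a (x * \prod_(j in A :\: B) r j).
  rewrite /colon /=.
  have -> : a * (x * \prod_(j in A :\: B) r j) =
      t * (\prod_(j in B) r j * \prod_(j in A :\: B) r j) - i * \prod_(j in A :\: B) r j.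
    by rewrite [t * _]mulrA -tE; ring.
  apply: idealB => //; last exact: idealMr.
  by apply: idealMl => //; move: MA; rewrite (big_setID B) /= (finset.setIidPr BA).
have [D DA Dn] : exists2 D : {set T}, D \subset A :\: B &
    (#|D| <= n)%N /\ colon M a (x * \prod_(j in D) r j).
  have [D DA [[Dn MD]|[Dn MD]]] := absorbingM aMa Mx; exists D => //; split=> //.
    by apply: idealMl => //; apply: ideal_colon.
  exact: ltnW.
have [DA' DB] := finset.subsetDP DA; have [Dn' MD] := Dn.
exists (B :|: D); split.
- by rewrite finset.subUset BA.
- by rewrite (leq_trans (leq_card_setU _ _)) ?leq_add.
apply: (satM t) => //; rewrite (big_setID B) /= finset.setUK.
rewrite finset.setDUl finset.setDv finset.set0U (finset.setDidPl DB) mulrA -tE mulrDl.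
apply: idealD => //; first exact: idealMr.
by rewrite -mulrA.
Qed.

(** One [t] in [S] sends the finitely many generators into [I], so the saturation of [I] is a single
    colon ideal [colon I (t * s)]. *)
Lemma S_Noetherian_absorbing : S_Noetherian S -> Omega S `<=` posnats.
Proof.
move=> noeR; apply/(Omega_absorbing hS) => I [iI _].
pose J := saturation I.
have [[s0 Ss0] SM] := hS.
have iJ : is_ideal J := ideal_saturation iI.
have satJ : saturated S J := @saturated_saturation _.
have [n aJ] := S_Noetherian_saturated_absorbing noeR iJ satJ.
have [s [_ [Ss _ [l ->] sJ lJ]]] := noeR J iJ.
have [t St tl] : exists2 t, S t & forall x, x \in l -> I (t * x).
  have : forall x, x \in l -> J x by move=> x xl; apply: lJ; apply: sub_idealgen.
  elim: l {sJ lJ} => [|x l IH] lJ; first by exists s0.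
  have [|t St tl] := IH; first by move=> y yl; apply: lJ; rewrite inE yl orbT.
  have [u Su ux] := lJ x (mem_head _ _); exists (t * u); first exact: SM.
  move=> y; rewrite inE => /orP[/eqP->|yl]; rewrite -mulrA; first exact: idealMl.
  by rewrite mulrCA; apply: idealMl => //; apply: tl.
exists (t * s); first exact: SM.
exists n; rewrite (_ : colon _ _ = J) //; apply/seteqP; split=> x.
  by exists (t * s) => //; apply: SM.
move=> Jx; rewrite /colon /= -mulrA.
apply: (idealgen_sub (ideal_colon iI t) tl).
by apply: sJ; exists x.
Qed.

(** Components not inside [M] are neutralised by a product [e] of elements they have outside [M];
    [e] is chosen before [x]. *)
Lemma finite_cap_locally M K : prime_ideal M -> finite_cap (@strongly_primary R) K ->
  exists2 e, ~ M e & forall x, K (e * x) \/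
    exists Q, [/\ strongly_primary Q, K `<=` Q, Q `<=` M & ~ Q x].
Proof.
move=> pM; elim=> [|Q J pQ _ [e Me eJ]]; first by exists 1; [apply: prime_ideal1 | left].
have [[iQ _ _] _] := pQ.
have away x : (exists Q', [/\ strongly_primary Q', J `<=` Q', Q' `<=` M & ~ Q' x]) ->
    exists Q', [/\ strongly_primary Q', Q `&` J `<=` Q', Q' `<=` M & ~ Q' x].
  by move=> [Q' [pQ' JQ' QM Qx]]; exists Q'; split=> // y [_ /JQ'].
have [[q [Qq Mq]]|QM] := pselect (exists q, Q q /\ ~ M q).
  exists (e * q); first exact: notP_mul.
  move=> x; have [Jx|/away] := eJ (q * x); last first.
    move=> [Q' [pQ' JQ' Q'M Q'x]]; right; exists Q'; split=> // Q'x'.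
    by apply: Q'x; apply: idealMl => //; case: pQ' => -[].
  left; split; last by rewrite -mulrA.
  by rewrite mulrAC; apply: idealMl.
have {}QM : Q `<=` M by move=> x Qx; apply: contrapT => Mx; apply: QM; exists x.
exists e => // x; have [Qx|Qx] := pselect (Q x); last first.
  by right; exists Q; split=> // y [].
by have [Jx|/away] := eJ x; [left; split=> //; apply: idealMl | right].
Qed.

(* In an arithmetical ring the ideal I is totally preordered by divisibility at
   M.  Without a maximal element, x0 in I with nonzero image at M would be
   divisible at M by arbitrarily long products of elements of M, although
   x0 * M is absorbing. *)
Lemma arithmetical_locally_principal M I : arithmetical R ->
  Omega S `<=` posnats -> prime_ideal M -> (forall x, M x -> ~ S x) -> is_ideal I ->
  exists2 x, I x & forall y, I y -> exists2 u, ~ M u & principal x (u * y).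
Proof.
move=> arR aS pM MS iI; apply: contrapT => nI.
have lask := (strongly_S_LaskerianP hS).1
  (absorbing_Laskerian hS (arithmetical_comparable arR) aS).
have [iM _ prM] := pM; have M1 := prime_ideal1 pM.
have next x : I x -> exists2 y, I y & forall u, ~ M u -> ~ principal x (u * y).
  move=> Ix; apply: contrapT => nx; apply: nI; exists x => // y Iy.
  apply: contrapT => ny; apply: nx; exists y => // u Mu xu.
  by apply: ny; exists u.
have step x : I x -> exists y u c, [/\ I y, ~ M u, M c & u * x = c * y].
  move=> Ix; have [y Iy ny] := next x Ix; exists y.
  have [u [v [uv1 [c _ cE] vy]]] := arithmetical_comaximal arR x y.
  have Mv : M v by apply: contrapT => /ny.
  have Mu : ~ M u by move=> Mu; apply: M1; rewrite -uv1; apply: idealD.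
  exists u, c; split=> //; last by rewrite -cE mulrC.
  apply: contrapT => Mc; apply: (ny c Mc); rewrite mulrC cE.
  by exists u; rewrite // mulrC.
(* Taking the zero ideal in [next] gives an [x0] that nothing outside [M] annihilates. *)
have [x0 Ix0 nx0] := next 0 (ideal0 iI).
pose B := [set x0 * m | m in M].
have iB : is_ideal B.
  split; first by exists 0; [apply: ideal0 | rewrite mulr0].
  - by move=> _ _ [m Mm <-] [m' Mm' <-]; exists (m + m'); [apply: idealD | rewrite mulrDr].
  - by move=> a _ [m Mm <-]; exists (a * m); [apply: idealMl | rewrite mulrCA].
have [|s Ss cB] := lask B.
  split=> //; apply/disjointE => t St [m Mm mE].
  by apply: (MS t) => //; rewrite -mE; apply: idealMl.
have [|e Me /(_ x0)[]] := @finite_cap_locally M (colon B s) pM.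
- by apply: finite_cap_mono cB => Q [].
(* In this case [s * e - m] annihilates [x0], although it lies outside [M]. *)
- move=> [m Mm mE]; apply: (nx0 (s * e - m)).
    move=> Msem; apply: (notP_mul pM (fun Ms => MS s Ms Ss) Me).
    by rewrite -(subrK m (s * e)); apply: idealD.
  by exists 0; rewrite // mulrBl -mulrA -mE; ring.
move=> [Q [[[iQ Q1 prQ] [k Qk]] BQ QM Qx0]].
have MQ : M `<=` radical Q.
  move=> m Mm; have : Q (x0 * m).
    by apply: BQ; apply: sub_colon => //; exists m.
  by case/prQ.
have divide j J : is_ideal J -> power_sub (radical Q) j J ->
    forall x, I x -> exists2 u, ~ M u & J (u * x).
  elim: j J => [|j IH] J iJ QJ x Ix.
    exists 1 => //; apply: idealMr => //.
    have := QJ _ (fun=> 0) (finset.set0 : {set unit}); rewrite big_set0; apply=> //.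
    by move=> i; rewrite inE.
  have [y [u [c [Iy Mu Mc uE]]]] := step x Ix.
  have [|v Mv vy] := IH (colon J c) (ideal_colon iJ c) _ y Iy.
    by apply: power_sub_colon QJ; apply: MQ.
  exists (v * u); first exact: notP_mul.
  by rewrite -mulrA uE mulrCA.
have [u Mu Qu] := divide k Q iQ Qk x0 Ix0.
move: Qu; rewrite mulrC => /prQ[//|/(radical_sub_prime pM QM)//].
Qed.

(** The multipliers sending [I] into a finitely generated subideal form an ideal [A]. If [A] missed
    [S], a prime [M] over [A] would miss [S] too, and the local generator at [M] yields a multiplier
    outside [M]. *)
Lemma arithmetical_S_Noetherian : arithmetical R ->
  Omega S `<=` posnats -> S_Noetherian S.
Proof.
move=> arR aS I iI.
have lask := (strongly_S_LaskerianP hS).1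
  (absorbing_Laskerian hS (arithmetical_comparable arR) aS).
pose gen (l : seq R) := ideal_gen [set x | x \in l].
pose A := [set a | exists2 l, (forall x, x \in l -> I x) & forall y, I y -> gen l (a * y)].
have iA : is_ideal A.
  split.
  - by exists [::] => // y _; rewrite mul0r; apply: (ideal0 (@ideal_idealgen R _)).
  - move=> a b [l lI al] [l' l'I bl']; exists (l ++ l').
      by move=> x; rewrite mem_cat => /orP[/lI|/l'I].
    have mono l1 l2 : {subset l1 <= l2} -> gen l1 `<=` gen l2.
      move=> l12; apply: (idealgen_sub (@ideal_idealgen R _)) => x /l12 xl.
      exact: sub_idealgen.
    move=> y Iy; rewrite mulrDl; apply: (idealD (@ideal_idealgen R _)).
      by apply: mono (al y Iy) => x xl; rewrite mem_cat xl.
    by apply: mono (bl' y Iy) => x xl; rewrite mem_cat xl orbT.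
  - move=> c a [l lI al]; exists l => // y /al; rewrite -mulrA.
    exact: (idealMl (@ideal_idealgen R _)).
have [[s [Ss [l lI sl]]]|AS] := pselect (exists s, S s /\ A s).
  exists s, (gen l); split=> //; first exact: ideal_idealgen.
  - by exists l.
  - by move=> _ [x Ix <-]; apply: sl.
  - exact: idealgen_sub.
have [S0 SM] := hS; exfalso.
have [x Ax Sx|M [pM AM MS _]] := exists_prime_disjoint S0 SM iA.
  by apply: AS; exists x.
have [x Ix xI] := arithmetical_locally_principal arR aS pM MS iI.
have single e : ~ M e -> ~ forall y, I y -> principal x (e * y).
  move=> Me ex; apply/Me/AM; exists [:: x]; first by move=> z; rewrite inE => /eqP->.
  move=> y /ex[z _ <-]; apply: (idealMr (@ideal_idealgen R _)).
  by apply: sub_idealgen; rewrite /= inE.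
(* If [x] is outside [M], it is itself such a multiplier; if inside, [xR] is disjoint from [S] and
   can be decomposed. *)
have [Mx|Mx] := pselect (M x); last by apply: (single x Mx) => y _; exists y.
have [|s Ss cx] := lask (principal x).
  split; first exact: ideal_principal.
  apply/disjointE => t St [y _ yE]; apply: (MS t) => //.
  by rewrite -yE; apply: idealMr => //; case: pM.
have [|e Me eK] := @finite_cap_locally M (colon (principal x) s) pM.
  by apply: finite_cap_mono cx => Q [].
apply: (single (s * e)); first by apply: notP_mul => // /MS.
(* The factor [u] depends on [y], but it cancels in every primary component inside [M], so the
   uniform [s * e] suffices. *)
move=> y Iy; rewrite -mulrA; have [//|[Q [[[iQ _ prQ] _] KQ QM []]]] := eK y.
have [u Mu uy] := xI y Iy.
have : Q (y * u).
  by rewrite mulrC; apply: KQ; apply: sub_colon => //; apply: ideal_principal.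
by case/prQ=> // /(radical_sub_prime pM QM).
Qed.

End Noetherian.

Theorem theorem4p6 (R : comPzRingType) (S : set R) (hS : multiplicative S) :
  ((strongly_S_Laskerian S -> Omega S `<=` posnats) /\
   (locally_divided R -> Omega S `<=` posnats -> strongly_S_Laskerian S)) /\
  (arithmetical R ->
   (S_Noetherian S <-> strongly_S_Laskerian S) /\
   (strongly_S_Laskerian S <-> Omega S `<=` posnats)).
Proof.
split; first split.
- exact: Laskerian_absorbing.
- by move=> /locally_divided_comparable; apply: absorbing_Laskerian.
move=> arR; have absL := absorbing_Laskerian hS (arithmetical_comparable arR).
split; split.
- by move=> /(S_Noetherian_absorbing hS).
- by move=> /(Laskerian_absorbing hS); apply: arithmetical_S_Noetherian.
- exact: Laskerian_absorbing.
- exact: absL.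
Qed.
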